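(* Some $k$-outerplanar graphs require pixel representations of size $\Omega(kn)$. Precisely: there is a constant $c>0$ such that for every integer $k\ge 1$ there are arbitrarily large integers $n$ for which there exists a $k$-outerplanar graph $G$ with $n$ vertices such that every pixel representation of $G$ has size at least $c\,k\,n$.
   Context: All graphs are finite and simple. A pixel is a cell of the unit square grid in the plane; two distinct pixels are adjacent if they share an edge (side). A blob is a nonempty finite set of pixels that is connected with respect to this adjacency. A pixel representation of a graph $G=(V,E)$ assigns to each vertex $v\in V$ a blob $B_v$ such that the blobs of distinct vertices are disjoint and, for all distinct $u,v\in V$, some pixel of $B_u$ is adjacent to some pixel of $B_v$ if and only if $uv\in E$. Its size is $\sum_{v\in V}|B_v|$. A plane embedding of a (nonempty) planar graph is $1$-outerplane if all vertices are on the outer face. For $k\ge 2$ it is $k$-outerplane if removing all vertices on the outer face yields a (nonempty) $(k-1)$-outerplane embedding; so repeatedly deleting all vertices on the current outer face empties the graph after exactly $k$ rounds. A planar graph is $k$-outerplanar if it admits a $k$-outerplane embedding but no $k'$-outerplane embedding for any $k'<k$. *)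

(* Defs.v *)
From HB Require Import structures.
From mathcomp Require Import all_boot all_order all_algebra finmap.
From mathcomp Require Import all_classical all_reals topology normedtype.
Set Implicit Arguments.
Unset Strict Implicit.
Unset Printing Implicit Defensive.
Import Order.TTheory GRing.Theory Num.Theory numFieldNormedType.Exports.
Local Open Scope classical_set_scope.
Local Open Scope ring_scope.

Record sgraph : Type := SGraph {
  vertex :> finType;
  adj : rel vertex;
  adj_sym : symmetric adj;
  adj_irrefl : irreflexive adj }.

(* The pair (i, j) stands for the grid cell [i, i+1] x [j, j+1]; two cells
   share a side exactly when one coordinate agrees and the other one differs
   by 1. *)
Definition pixel : Type := (int * int)%type.

Definition pixel_adj : rel pixel :=
  fun p q => ((p.1 == q.1) && (`|p.2 - q.2| == 1))
          || ((p.2 == q.2) && (`|p.1 - q.1| == 1)).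

Definition pixel_connected (B : {fset pixel}) : Prop :=
  forall p q : pixel, p \in B -> q \in B ->
    exists s : seq pixel,
      [/\ path pixel_adj p s, last p s = q & {subset s <= B}].

Definition blob (B : {fset pixel}) : Prop :=
  B != fset0 /\ pixel_connected B.

Definition pixel_touch (A B : {fset pixel}) : Prop :=
  exists p q : pixel, [/\ p \in A, q \in B & pixel_adj p q].

Record pixel_representation (G : sgraph) (B : G -> {fset pixel}) : Prop := {
  pixel_rep_blob : forall v, blob (B v);
  pixel_rep_disjoint : forall u v, u != v -> [disjoint B u & B v]%fset;
  pixel_rep_adj : forall u v, u != v -> (pixel_touch (B u) (B v) <-> adj u v) }.

Definition pixel_size (G : sgraph) (B : G -> {fset pixel}) : nat :=
  (\sum_(v : G) #|` B v|)%N.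

Definition plane (R : realType) : normedModType R := (R * R)%type.

Definition is_arc (R : realType) (p q : plane R) (A : set (plane R)) : Prop :=
  exists gamma : R -> plane R,
    [/\ {within `[0, 1], continuous gamma},
        set_inj `[0, 1] gamma,
        gamma 0 = p,
        gamma 1 = q &
        gamma @` `[0, 1] = A].

(* [edge_arc u v] is meaningful only when [u] and [v] are adjacent. *)
Record plane_embedding (R : realType) (G : sgraph) : Type := PlaneEmbedding {
  vertex_pt : G -> plane R;
  edge_arc : G -> G -> set (plane R);
  vertex_pt_inj : injective vertex_pt;
  edge_arc_sym : forall u v, adj u v -> edge_arc u v = edge_arc v u;
  edge_arcP : forall u v, adj u v ->
    is_arc (vertex_pt u) (vertex_pt v) (edge_arc u v);
  edge_arc_vertex : forall u v w, adj u v ->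
    edge_arc u v (vertex_pt w) -> w = u \/ w = v;
  edge_arc_cross : forall u v x y, adj u v -> adj x y ->
    (u, v) <> (x, y) -> (u, v) <> (y, x) ->
    forall p, edge_arc u v p -> edge_arc x y p ->
    exists w, [/\ p = vertex_pt w, w = u \/ w = v & w = x \/ w = y] }.

Section Outerplane.
Variables (R : realType) (G : sgraph) (E : plane_embedding R G).

(* Point set of the embedding restricted to the subgraph induced by [S]. *)
Definition drawing (S : set G) : set (plane R) :=
  [set p | (exists2 v, S v & p = vertex_pt E v) \/
           (exists u v, [/\ S u, S v, adj u v & edge_arc E u v p])].

(* Faces are the connected components of the complement of the drawing; the
   drawing being compact, exactly one of them is unbounded. *)
Definition outer_face (S : set G) : set (plane R) :=
  [set p | (~` drawing S) p /\
           ~ bounded_set (connected_component (~` drawing S) p)].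

(* A vertex is on a face when it lies on the boundary of that face. *)
Definition outer_vertices (S : set G) : set G :=
  [set v | S v /\ closure (outer_face S) (vertex_pt E v)].

Fixpoint outerplane_on (k : nat) (S : set G) : Prop :=
  match k with
  | 0 => False
  | 1 => S !=set0 /\ S `<=` outer_vertices S
  | k'.+1 => outerplane_on k' (S `\` outer_vertices S)
  end.

Definition outerplane (k : nat) : Prop := outerplane_on k [set: G].

End Outerplane.

Definition outerplanar (R : realType) (k : nat) (G : sgraph) : Prop :=
  (exists E : plane_embedding R G, outerplane E k) /\
  (forall k' : nat, (k' < k)%N ->
     ~ exists E : plane_embedding R G, outerplane E k').

(* Main.v *)
Require Import Defs.
From mathcomp Require Import all_boot all_order all_algebra finmap.
From mathcomp Require Import all_classical all_reals topology normedtype.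
From mathcomp Require Import zify ring lra.
Set Implicit Arguments.
Unset Strict Implicit.
Unset Printing Implicit Defensive.
Import Order.TTheory GRing.Theory Num.Theory numFieldNormedType.Exports.
Local Open Scope classical_set_scope.
Local Open Scope ring_scope.

(** The graph consists of [p] copies of [k] nested 4-cycles (consecutive cycles
    being joined by four radial edges) and of one more vertex [a] adjacent to
    two opposite vertices of the outermost cycle of each copy. If the outer face
    meets a vertex [x], then in every copy that does not contain [x] the j-th
    cycle separates the cycles inside it from the outer face: otherwise two
    opposite vertices of that cycle and what lies inside it, against the two
    other vertices and the outside (connected through [a] and the outer face),
    would form a K33. Hence every embedding has at least [k] layers, and in a
    pixel representation, after excluding the copy of a topmost pixel, each of
    the remaining discs bounded by the cycles is strictly wider than the one
    inside it while the topmost pixel of each of its columns belongs to its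
    boundary cycle; so each remaining copy has size at least k (k + 1) / 2.
    For [k = 1] an edgeless graph suffices.

    Both arguments rest on the absence of K33 in the pixel grid. For three
    internally disjoint lattice walks from P to Q, let w_i be the winding parity
    at v + (1/2, 1/2) of the closed walk formed by the other two, for v on the
    i-th walk. Then w_1 + w_2 + w_3 is odd by a local count at P, whereas a
    common neighbor of the three walks would make it even. The plane case
    reduces to the grid: compact connected sets are replaced by the lattice
    points close to them, on a sufficiently fine grid. *)

(** * Winding parity of lattice walks *)

(** Embeddings and representations are arbitrary, so a copy may be turned inside out, with the outer
    face or the topmost pixel deep inside its rings. This can spoil only one copy, hence at least
    two are needed; further copies let the number of vertices grow while [k] stays fixed. The vertex
    [a] keeps all vertices off a disk connected, so that the outside of a disk can act as one vertex
    of the K33. The K33 uses outward edges at two opposite vertices of a ring and inward edges at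
    the other two.

    Phrasing separation through K33 keeps closed curves and their interiors out of the plane
    argument: only connectedness, incidence and disjointness of compact sets have to survive
    discretization.

    The upper bound on the number of layers needs an actual drawing: concentric diamonds, the copies
    side by side, [a] far below. The edges at [a] may hide the lowest vertex of an outermost ring in
    the first round; it goes in the second, at no cost if there are two rings. With a single ring,
    its horizontal vertices against the other two and [a] form a K_{2,3}, which is not
    1-outerplanar. *)

Lemma pixel_adj_sym : symmetric pixel_adj.
Proof.
by move=> p q; rewrite /pixel_adj eq_sym distrC [q.2 == _]eq_sym (distrC q.1).
Qed.

Fixpoint step_parity (f : pixel -> pixel -> bool) (p : pixel) (s : seq pixel) :=
  if s is q :: s' then f p q (+) step_parity f q s' else false.

Lemma step_parity_addb f g h p s :
  (forall a b, pixel_adj a b -> f a b (+) g a b = h a b) ->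
  path pixel_adj p s ->
  step_parity f p s (+) step_parity g p s = step_parity h p s.
Proof.
move=> fgh; elim: s p => //= q s IH p /andP[pq qs].
by rewrite -(fgh _ _ pq) -(IH _ qs) addbACA.
Qed.

Lemma step_parity_telescope (f : pixel -> bool) p s :
  step_parity (fun a b => f a (+) f b) p s = f p (+) f (last p s).
Proof.
elim: s p => [|q s IH] p /=; first by rewrite addbb.
by rewrite IH addbA; case: (f p); case: (f q); case: (f _).
Qed.

Lemma step_parity_notin (f : pixel -> pixel -> bool) v p s :
  (forall a b, f a b -> a = v \/ b = v) -> v \notin p :: s ->
  step_parity f p s = false.
Proof.
move=> fv; elim: s p => //= q s IH p.
rewrite !inE !negb_or => /and3P[vp vq vs].
rewrite IH ?inE ?negb_or ?vq // addbF; apply/negP => /fv[]/eqP.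
  by rewrite eq_sym (negPf vp).
by rewrite eq_sym (negPf vq).
Qed.

Definition is_edge (u v a b : pixel) : bool :=
  ((a == u) && (b == v)) || ((a == v) && (b == u)).

Lemma step_parity_start (v p q : pixel) s : p \notin q :: s -> p != v ->
  step_parity (is_edge p v) p (q :: s) = (q == v).
Proof.
move=> pqs pv /=; rewrite (@step_parity_notin _ p) //; last first.
  by move=> a b /orP[] /andP[/eqP-> /eqP->]; [left|right].
rewrite addbF /is_edge eqxx (negPf pv) /= orbF //.
Qed.

(* [winding v p s] is the parity of the number of crossings of the walk [p :: s]
   with the horizontal ray that leaves [v + (1/2, 1/2)] to the right. *)
Definition ray_cross (v a b : pixel) : bool :=
  [&& v.1 < a.1, a.1 == b.1 &
      ((a.2 == v.2) && (b.2 == v.2 + 1)) || ((b.2 == v.2) && (a.2 == v.2 + 1))].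

Definition winding v p s := step_parity (ray_cross v) p s.

Definition right_of (v : pixel) : pixel := (v.1 + 1, v.2).
Definition above (v : pixel) : pixel := (v.1, v.2 + 1).

(** The two rays differ by a unit segment, which meets a single vertical grid edge, the one going up
    from [right_of v]. *)
Lemma winding_right v p s : path pixel_adj p s ->
  winding v p s (+) winding (right_of v) p s =
  step_parity (is_edge (right_of v) (above (right_of v))) p s.
Proof.
apply: step_parity_addb => -[a1 a2] [b1 b2] _; case: v => x y.
rewrite /ray_cross /is_edge /right_of /above /= !xpair_eqE; lia.
Qed.

Lemma pixel_adjP p q : reflect
  [\/ q = right_of p, p = right_of q, q = above p | p = above q] (pixel_adj p q).
Proof.
case: p q => [x y] [x' y']; rewrite /right_of /above /pixel_adj /=.
apply: (iffP idP).
  move=> H.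
  have {H} : [|| (x' == x + 1) && (y' == y), (x == x' + 1) && (y == y'),
     (x' == x) && (y' == y + 1) | (x == x') && (y == y' + 1)] by lia.
  case/or4P => /andP[/eqP-> /eqP->].
  - exact: Or41.
  - exact: Or42.
  - exact: Or43.
  - exact: Or44.
by case=> -[-> ->]; lia.
Qed.

(** Between the two rays lies a half-row of lattice points. A walk enters or leaves it across one of
    the rays or along the edge from [above v] to [right_of (above v)]; the end terms record whether
    the walk starts or stops there. *)
Lemma winding_above v p s : path pixel_adj p s ->
  winding v p s (+) winding (above v) p s =
  step_parity (is_edge (above v) (right_of (above v))) p s (+)
  (((v.1 < p.1) && (p.2 == v.2 + 1)) (+)
   ((v.1 < (last p s).1) && ((last p s).2 == v.2 + 1))).
Proof.
move=> ps.
pose f (a : pixel) := (v.1 < a.1) && (a.2 == v.2 + 1).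
rewrite -/(f p) -/(f (last p s)) -(step_parity_telescope f).
rewrite (step_parity_addb (fun _ _ _ => erefl _) ps).
apply: step_parity_addb ps => a b /pixel_adjP ab; rewrite /f; case: v {f} => x y.
rewrite /ray_cross /is_edge.
case: ab => ->.
- case: a => c d; rewrite /right_of /above /= !xpair_eqE /=; lia.
- case: b => c d; rewrite /right_of /above /= !xpair_eqE /=; lia.
- case: a => c d; rewrite /right_of /above /= !xpair_eqE /=; lia.
- case: b => c d; rewrite /right_of /above /= !xpair_eqE /=; lia.
Qed.

Lemma is_edge_notin u v p s : u \notin p :: s ->
  step_parity (is_edge u v) p s = false.
Proof.
by apply: step_parity_notin => c d /orP[]/andP[/eqP-> /eqP->]; [left|right].
Qed.

Lemma addb_eq0 (a b : bool) : a (+) b = false -> a = b.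
Proof. by case: a; case: b. Qed.

Section WindingPair.
Variables (p : pixel) (s s' : seq pixel).
Hypotheses (ps : path pixel_adj p s) (ps' : path pixel_adj p s').
Hypothesis lss' : last p s = last p s'.

Definition winding2 v := winding v p s (+) winding v p s'.

Lemma winding2_right v : winding2 v (+) winding2 (right_of v) =
  step_parity (is_edge (right_of v) (above (right_of v))) p s (+)
  step_parity (is_edge (right_of v) (above (right_of v))) p s'.
Proof. by rewrite -!winding_right // addbACA. Qed.

Lemma winding2_above v : winding2 v (+) winding2 (above v) =
  step_parity (is_edge (above v) (right_of (above v))) p s (+)
  step_parity (is_edge (above v) (right_of (above v))) p s'.
Proof.
rewrite /winding2 addbACA !winding_above // lss'.
set X := step_parity _ p s; set Y := step_parity _ p s'; set Z := _ (+) (_ && _).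
by case: X Y Z => [] [] [].
Qed.

(** The grid edge met between the base points of [u] and [v] has the upper or right one of these two
    pixels as an end, and neither walk visits it. *)
Lemma winding2_step u v : pixel_adj u v ->
  u \notin p :: s -> u \notin p :: s' -> v \notin p :: s -> v \notin p :: s' ->
  winding2 u = winding2 v.
Proof.
have R w : right_of w \notin p :: s -> right_of w \notin p :: s' ->
    winding2 w = winding2 (right_of w).
  by move=> ws ws'; apply: addb_eq0; rewrite winding2_right !is_edge_notin.
have A w : above w \notin p :: s -> above w \notin p :: s' ->
    winding2 w = winding2 (above w).
  by move=> ws ws'; apply: addb_eq0; rewrite winding2_above !is_edge_notin.
case/pixel_adjP => -> us us' vs vs'.
- exact: R.
- by symmetry; apply: R.
- exact: A.
- by symmetry; apply: A.
Qed.

Lemma winding2_walk u t : path pixel_adj u t ->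
  {in u :: t, forall x, x \notin p :: s /\ x \notin p :: s'} ->
  winding2 u = winding2 (last u t).
Proof.
elim: t u => //= v t IH u /andP[uv vt] H.
rewrite -IH //; last by move=> x xt; apply: H; rewrite inE xt orbT.
have [us us'] := H u (mem_head _ _).
have [] := H v; first by rewrite !inE eqxx orbT.
exact: winding2_step.
Qed.

End WindingPair.

Definition neighbor (p : pixel) (d : bool * bool) : pixel :=
  match d with
  | (false, false) => right_of p
  | (false, true) => (p.1 - 1, p.2)
  | (true, false) => above p
  | (true, true) => (p.1, p.2 - 1)
  end.

Lemma neighbor_inj p : injective (neighbor p).
Proof.
case: p => x y [[] []] [[] []] //=; rewrite /right_of /above /= => -[]; lia.
Qed.

Lemma pixel_adj_neighbor p q : pixel_adj p q -> exists d, q = neighbor p d.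
Proof.
case/pixel_adjP => ->.
- by exists (false, false).
- by exists (false, true); case: q => x y; rewrite /= addrK.
- by exists (true, false).
- by exists (true, true); case: q => x y; rewrite /= addrK.
Qed.

(* Passing from [p + (1/2, 1/2)] to [neighbor p d + (1/2, 1/2)] crosses an edge
   incident to [p] only when [d] is left (the edge up) or down (the edge to the
   right). *)
Definition crossed_dir (d d' : bool * bool) : bool :=
  ((d == (false, true)) && (d' == (true, false))) ||
  ((d == (true, true)) && (d' == (false, false))).

(** If [d1] is right or up, the crossed edge ends at [P d1], which both walks avoid. If [d1] is left
    or down, it ends at [p], to which no walk returns, so only the first steps can use it. *)
Lemma winding2_start p d1 d2 d3 (P := neighbor p) s2 s3 :
  path pixel_adj p (P d2 :: s2) -> path pixel_adj p (P d3 :: s3) ->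
  last (P d2) s2 = last (P d3) s3 ->
  p \notin P d2 :: s2 -> p \notin P d3 :: s3 ->
  P d1 \notin P d2 :: s2 -> P d1 \notin P d3 :: s3 ->
  winding2 p (P d2 :: s2) (P d3 :: s3) p (+)
  winding2 p (P d2 :: s2) (P d3 :: s3) (P d1) =
  crossed_dir d1 d2 (+) crossed_dir d1 d3.
Proof.
move=> ps2 ps3 l23 p2 p3 d12 d13.
have P1p : P d1 != p.
  by rewrite /P; case: p d1 {P ps2 ps3 l23 p2 p3 d12 d13} => x y [[] []] /=;
     rewrite xpair_eqE /=; lia.
have n2 : P d1 \notin p :: P d2 :: s2 by rewrite inE negb_or P1p.
have n3 : P d1 \notin p :: P d3 :: s3 by rewrite inE negb_or P1p.
have pP d : p != P d.
  by rewrite /P; case: p d {P ps2 ps3 l23 p2 p3 d12 d13 P1p n2 n3} => x y [[] []] /=;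
     rewrite xpair_eqE /=; lia.
have Pinj : injective P := @neighbor_inj p.
case: d1 P1p n2 n3 d12 d13 => -[] [] P1p n2 n3 d12 d13.
- have e : above (P (true, true)) = p by rewrite /P /above /= subrK; case: (p).
  rewrite addbC -{3}e winding2_above // e -[right_of p]/(P (false, false)).
  by rewrite !step_parity_start ?(pP (false, false)) // !(inj_eq Pinj).
- rewrite winding2_above // !is_edge_notin //.
- have e : right_of (P (false, true)) = p by rewrite /P /right_of /= subrK; case: (p).
  rewrite addbC -{3}e winding2_right // e -[above p]/(P (true, false)).
  by rewrite !step_parity_start ?(pP (true, false)) // !(inj_eq Pinj) /crossed_dir /= !orbF.
- rewrite winding2_right // !is_edge_notin //.
Qed.

(** The pairs counted are left with up and down with right. They partition the four directions, so
    omitting one direction leaves exactly one of them whole. *)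
Lemma crossed_dir_sum d1 d2 d3 : d1 != d2 -> d1 != d3 -> d2 != d3 ->
  (crossed_dir d1 d2 (+) crossed_dir d1 d3) (+)
  (crossed_dir d2 d1 (+) crossed_dir d2 d3) (+)
  (crossed_dir d3 d1 (+) crossed_dir d3 d2).
Proof. by move: d1 d2 d3 => [[] []] [[] []] [[] []]. Qed.

Lemma theta_pixel p s1 s2 s3 f t1 t2 t3 (P1 := head p s1) (P2 := head p s2) (P3 := head p s3) :
  path pixel_adj p s1 -> path pixel_adj p s2 -> path pixel_adj p s3 ->
  s1 != [::] -> s2 != [::] -> s3 != [::] ->
  last p s1 = last p s2 -> last p s2 = last p s3 ->
  p \notin s1 -> p \notin s2 -> p \notin s3 ->
  path pixel_adj P1 t1 -> path pixel_adj P2 t2 -> path pixel_adj P3 t3 ->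
  last P1 t1 = f -> last P2 t2 = f -> last P3 t3 = f ->
  {in P1 :: t1, forall x, x \notin p :: s2 /\ x \notin p :: s3} ->
  {in P2 :: t2, forall x, x \notin p :: s1 /\ x \notin p :: s3} ->
  {in P3 :: t3, forall x, x \notin p :: s1 /\ x \notin p :: s2} ->
  False.
Proof.
rewrite /P1 /P2 /P3 => {P1 P2 P3}.
case: s1 => // P1 s1; case: s2 => // P2 s2; case: s3 => // P3 s3.
move=> ps1 ps2 ps3 _ _ _ l12 l23 p1 p2 p3 t1P t2P t3P lt1 lt2 lt3 n1 n2 n3.
have := ps1 => /= /andP[/pixel_adj_neighbor[d1 e1] _].
have := ps2 => /= /andP[/pixel_adj_neighbor[d2 e2] _].
have := ps3 => /= /andP[/pixel_adj_neighbor[d3 e3] _].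
move: t1P t2P t3P lt1 lt2 lt3 n1 n2 n3 => /= t1P t2P t3P lt1 lt2 lt3 n1 n2 n3.
have W1 := winding2_walk ps2 ps3 l23 t1P n1.
have l13 := etrans l12 l23.
have W2 := winding2_walk ps1 ps3 l13 t2P n2.
have W3 := winding2_walk ps1 ps2 l12 t3P n3.
have [m12 m13] := n1 _ (mem_head _ _).
have [m21 m23] := n2 _ (mem_head _ _).
have [m31 m32] := n3 _ (mem_head _ _).
have d12 : d1 != d2 by apply: contra m12 => /eqP dd; rewrite e1 e2 dd !inE eqxx orbT.
have d13 : d1 != d3 by apply: contra m13 => /eqP dd; rewrite e1 e3 dd !inE eqxx orbT.
have d23 : d2 != d3 by apply: contra m23 => /eqP dd; rewrite e2 e3 dd !inE eqxx orbT.
have notin_behead (x y : pixel) s : x \notin y :: s -> x \notin s.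
  by rewrite inE negb_or => /andP[].
move: (m12) (m13) (m21) (m23) (m31) (m32) => /notin_behead m12' /notin_behead m13'
  /notin_behead m21' /notin_behead m23' /notin_behead m31' /notin_behead m32'.
subst P1 P2 P3.
have S1 := winding2_start ps2 ps3 l23 p2 p3 m12' m13'.
have S2 := winding2_start ps1 ps3 l13 p1 p3 m21' m23'.
have S3 := winding2_start ps1 ps2 l12 p1 p2 m31' m32'.
move: W1 W2 W3 S1 S2 S3; rewrite lt1 lt2 lt3 => -> -> ->; rewrite /winding2.
have := crossed_dir_sum d12 d13 d23.
move=> sum e1 e2 e3; move: sum; rewrite -e1 -e2 -e3.
(* The three equations are added up: at [p], and again at [f], each winding parity occurs twice and
   cancels, whereas the right-hand sides add up to 1. *)
do 6 (case: (winding _ _ _)) => //.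
Qed.

(** * K33 in the pixel grid *)

Section Linked.
Variables (T : eqType) (e : rel T).
Implicit Types (X Y : set T) (p q r : T).

Definition linked X p q : Prop :=
  exists s, [/\ path e p s, last p s = q & {in p :: s, forall x, X x}].

Definition walk_connected X : Prop :=
  forall p q, X p -> X q -> linked X p q.

Definition touch X Y : Prop := exists p q, [/\ X p, Y q & e p q].

Lemma linked_refl X p : X p -> linked X p p.
Proof. by move=> Xp; exists [::]; split => // x; rewrite inE => /eqP->. Qed.

Lemma linked_step X p q : X p -> X q -> e p q -> linked X p q.
Proof.
move=> Xp Xq pq; exists [:: q]; split; rewrite /= ?pq //.
by move=> x; rewrite !inE => /orP[]/eqP->.
Qed.

Lemma linked_trans X p q r : linked X p q -> linked X q r -> linked X p r.
Proof.
move=> [s [ps <- Xs]] [t [qt <- Xt]]; exists (s ++ t).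
split; rewrite ?cat_path ?ps ?last_cat // => x.
rewrite -cat_cons mem_cat => /orP[]; first exact: Xs.
by move=> xt; apply: Xt; rewrite inE xt orbT.
Qed.

Lemma linked_sub X Y p q : X `<=` Y -> linked X p q -> linked Y p q.
Proof. by move=> XY [s [ps qs Xs]]; exists s; split => // x /Xs /XY. Qed.

Lemma linked_end X p q : linked X p q -> X p /\ X q.
Proof.
move=> [s [_ <- Xs]]; split; apply: Xs; first exact: mem_head.
exact: mem_last.
Qed.

Hypothesis e_sym : symmetric e.

Lemma linked_sym X p q : linked X p q -> linked X q p.
Proof.
move=> [s [ps <- Xs]]; exists (rev (belast p s)); split.
- by rewrite rev_path; under eq_path => x y do rewrite e_sym.
- by case: s {ps Xs} => //= a s; rewrite rev_cons last_rcons.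
- by move=> x; rewrite inE mem_rev => xs; apply: Xs; rewrite lastI mem_rcons inE.
Qed.

Lemma walk_connected_center X p : (forall q, X q -> linked X p q) -> walk_connected X.
Proof.
by move=> pX q r /pX pq /pX pr; apply: linked_trans pr; apply: linked_sym.
Qed.

Lemma walk_connectedU X Y : walk_connected X -> walk_connected Y -> touch X Y ->
  walk_connected (X `|` Y).
Proof.
move=> Xc Yc [x [y [Xx Yy xy]]]; apply: (@walk_connected_center _ x) => p.
case=> [Xp|Yp]; first by apply: linked_sub (Xc _ _ Xx Xp); left.
apply: (@linked_trans _ _ y); first by apply: linked_step => //; [left|right].
by apply: linked_sub (Yc _ _ Yy Yp); right.
Qed.

End Linked.

Lemma last_exit (S : {pred pixel}) a t : a \in S -> path pixel_adj a t ->
  exists p u, [/\ p \in S, path pixel_adj p u, last p u = last a t,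
    {in u, forall x, x \notin S} & {subset u <= t}].
Proof.
move=> aS; elim/last_ind: t => [|t b IH]; first by exists a, [::].
rewrite rcons_path last_rcons => /andP[/IH[p [u [pS pu lu nu ut]]] tb].
have [bS|bS] := boolP (b \in S); first by exists b, [::].
exists p, (rcons u b); split => //.
- by rewrite rcons_path pu lu.
- by rewrite last_rcons.
- by move=> x; rewrite mem_rcons inE => /orP[/eqP->//|/nu].
- by move=> x; rewrite !mem_rcons !inE => /orP[->//|/ut ->]; rewrite orbT.
Qed.

(** A walk from [c1] to [c2] is shortened to a simple path; the last point of a walk from [c1] to
    [c3] that lies on this path is the center [p]. The legs are the two parts of the path and the
    rest of the walk; any of them may be empty. *)
Lemma tripod X c1 c2 c3 : walk_connected pixel_adj X -> X c1 -> X c2 -> X c3 ->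
  exists p u1 u2 u3,
  [/\ [/\ path pixel_adj p u1, last p u1 = c1, p \notin u1 & {in p :: u1, forall x, X x}],
      [/\ path pixel_adj p u2, last p u2 = c2, p \notin u2 & {in p :: u2, forall x, X x}],
      [/\ path pixel_adj p u3, last p u3 = c3, p \notin u3 & {in p :: u3, forall x, X x}] &
      [/\ {in u1, forall x, x \notin u2}, {in u1, forall x, x \notin u3} &
          {in u2, forall x, x \notin u3}]].
Proof.
move=> Xc X1 X2 X3.
have [s0 [ps0 ls0 Xs0]] := Xc _ _ X1 X2.
have [s [ps ls us Xs]] : exists s, [/\ path pixel_adj c1 s, last c1 s = c2,
    uniq (c1 :: s) & {in c1 :: s, forall x, X x}].
  case: (shortenP ps0) ls0 => s ps us ss0 ls; exists s; split => // x.
  by rewrite inE => /orP[/eqP->//|/ss0 xs]; apply: Xs0; rewrite inE xs orbT.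
have [t [pt lt Xt]] := Xc _ _ X1 X3.
have [p [u [pS pu lu nu ut]]] := @last_exit (mem (c1 :: s)) c1 t (mem_head _ _) pt.
have {pS} pS : p \in c1 :: s by [].
have {}nu x : x \in u -> x \notin c1 :: s by exact: nu.
case/splitPl: pS ps ls us Xs nu => s1 s2 lp.
rewrite cat_path => /andP[ps1 ps2]; rewrite last_cat lp => ls us Xs nu.
rewrite lp in ps2.
move: us Xs; rewrite -cat_cons lastI lp cat_uniq rcons_uniq => /and3P[/andP[pb ub] nh us2] Xs.
have nb x : x \in belast c1 s1 -> x \notin s2.
  move=> xb; apply: contra nh => xs; apply/hasP; exists x => //.
  by rewrite /= mem_rcons inE xb orbT.
have nu' x : x \in u -> [/\ x != p, x \notin belast c1 s1 & x \notin s2].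
  move=> /nu; rewrite -cat_cons lastI lp mem_cat mem_rcons inE !negb_or.
  by rewrite -andbA => /and3P[].
have pX : X p by apply: Xs; rewrite mem_cat mem_rcons mem_head.
exists p, (rev (belast c1 s1)), s2, u; split; split => //.
- by rewrite -lp rev_path; under eq_path => x y do rewrite pixel_adj_sym.
- by case: (s1) lp => //= a s1' _; rewrite rev_cons last_rcons.
- by rewrite mem_rev.
- move=> x; rewrite inE mem_rev => xb; apply: Xs.
  by rewrite mem_cat mem_rcons inE xb.
- by apply: contra nh => ps; apply/hasP; exists p => //=; rewrite mem_rcons mem_head.
- move=> x; rewrite inE => xs; apply: Xs.
  by rewrite mem_cat mem_rcons inE orbAC xs.
- by rewrite lu.
- by apply/negP => /nu' []; rewrite eqxx.
- by move=> x; rewrite inE => /orP[/eqP->//|/ut xt]; apply: Xt; rewrite inE xt orbT.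
- by move=> x; rewrite mem_rev; apply: nb.
- by move=> x; rewrite mem_rev => xb; apply/negP => /nu'[_]; rewrite xb.
- by move=> x xs; apply/negP => /nu'[_ _]; rewrite xs.
Qed.

(** One branch of a theta: a leg [u] of the tripod is prolonged through [A] to the point [q] of [Q].
    The walk [t] leads from the first pixel after [p] to [f], along the rest of the leg and then
    through [A] and [F]. *)
Lemma branch (A Q F : set pixel) p u c q f :
  walk_connected pixel_adj A -> walk_connected pixel_adj Q -> walk_connected pixel_adj F ->
  path pixel_adj p u -> last p u = c -> p \notin u ->
  (exists2 a, A a & pixel_adj c a) -> touch pixel_adj A Q -> touch pixel_adj A F -> Q q -> F f ->
  ~ A p -> ~ Q p ->
  exists s t, let h := head p s in
  [/\ [/\ path pixel_adj p s, s != [::], last p s = q & p \notin s],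
      {in s, forall x, x \in u \/ (A `|` Q) x},
      path pixel_adj h t, last h t = f &
      {in h :: t, forall x, x \in u \/ (A `|` F) x}].
Proof.
move=> Ac Qc Fc pu lu nu [a Aa ca] AQ AF Qq Ff nA nQ.
have [s [ps ls Xs]] := walk_connectedU pixel_adj_sym Ac Qc AQ (or_introl Aa) (or_intror Qq).
have [t [pt lt Xt]] : linked pixel_adj ([set x | x \in u] `|` (A `|` F))
    (head p (u ++ a :: s)) f.
  apply: (@linked_trans _ _ _ _ a); last first.
    apply: linked_sub (walk_connectedU pixel_adj_sym Ac Fc AF (or_introl Aa) (or_intror Ff)).
    by move=> x; right.
  case: u pu lu nu => [|b u] /= pu lu nu.
    by apply: linked_refl; right; left.
  case/andP: pu => _ pu.
  apply: (@linked_trans _ _ _ _ c).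
    exists u; split => // x xu; by left.
  by apply: linked_step => //; [left; rewrite /= -lu mem_last|right; left].
exists (u ++ a :: s), t; split => //.
- split.
  + by rewrite cat_path pu lu /= ca.
  + by case: (u).
  + by rewrite last_cat.
  + rewrite mem_cat negb_or nu; apply/negP => /Xs [].
      exact: nA.
    exact: nQ.
- by move=> x; rewrite mem_cat => /orP[|/Xs]; [left|right].
Qed.

(** The theta branches at the center of a tripod in [B j0], ends in [B j1], and its three walks pass
    through three sets [A i]. The set [B j2] provides the common target [f] that [theta_pixel]
    excludes. *)
Theorem K33_pixel (I J : finType) (A : I -> set pixel) (B : J -> set pixel) :
  (2 < #|I|)%N -> (2 < #|J|)%N ->
  (forall i, walk_connected pixel_adj (A i)) -> (forall j, walk_connected pixel_adj (B j)) ->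
  (forall i i', i != i' -> A i `&` A i' = set0) ->
  (forall j j', j != j' -> B j `&` B j' = set0) ->
  (forall i j, A i `&` B j = set0) ->
  (forall i j, touch pixel_adj (A i) (B j)) -> False.
Proof.
move=> /card_gt2P[i0 [i1 [i2 [_ [i01 i12 i20]]]]] /card_gt2P[j0 [j1 [j2 [_ [d01 d12 d20]]]]].
move=> Ac Bc AA BB AB T.
have d02 : j0 != j2 by rewrite eq_sym.
have i02 : i0 != i2 by rewrite eq_sym.
have disj (X Y : set pixel) x : X `&` Y = set0 -> X x -> Y x -> False.
  by move=> XY Xx Yx; have : set0 x by rewrite -XY.
have C i : exists2 c, B j0 c & exists2 a, A i a & pixel_adj c a.
  by have [a [c [Aa Bc' ac]]] := T i j0; exists c => //; exists a; rewrite // pixel_adj_sym.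
have [c1 B1 a1] := C i0; have [c2 B2 a2] := C i1; have [c3 B3 a3] := C i2.
have [p [u1 [u2 [u3]]]] := tripod (Bc j0) B1 B2 B3.
move=> [[pu1 lu1 nu1 Xu1] [pu2 lu2 nu2 Xu2] [pu3 lu3 nu3 Xu3] [n12 n13 n23]].
have [_ [q [_ Qq _]]] := T i0 j1; have [_ [f [_ Ff _]]] := T i0 j2.
have Bp : B j0 p by apply: Xu1; exact: mem_head.
have nA i : ~ A i p by move=> Ap; apply: disj (AB i j0) Ap Bp.
have nB : ~ B j1 p by apply: disj (BB _ _ d01) Bp.
have [s1 [t1 [[ps1 s10 ls1 ns1] Xs1 pt1 lt1 Xt1]]] :=
  branch (Ac i0) (Bc j1) (Bc j2) pu1 lu1 nu1 a1 (T _ _) (T _ _) Qq Ff (nA _) nB.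
have [s2 [t2 [[ps2 s20 ls2 ns2] Xs2 pt2 lt2 Xt2]]] :=
  branch (Ac i1) (Bc j1) (Bc j2) pu2 lu2 nu2 a2 (T _ _) (T _ _) Qq Ff (nA _) nB.
have [s3 [t3 [[ps3 s30 ls3 ns3] Xs3 pt3 lt3 Xt3]]] :=
  branch (Ac i2) (Bc j1) (Bc j2) pu3 lu3 nu3 a3 (T _ _) (T _ _) Qq Ff (nA _) nB.
(* This is the avoidance required by [theta_pixel]: the legs are disjoint by [tripod], the other
   pairs of pieces by hypothesis. *)
have sep i i' u u' s t (h := head p t) : i != i' -> 
    {in p :: u, forall x, B j0 x} -> {in p :: u', forall x, B j0 x} -> p \notin u ->
    (forall x, x \in u -> x \in u' -> False) ->
    {in s, forall x, x \in u' \/ (A i' `|` B j1) x} ->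
    forall x, x \in u \/ (A i `|` B j2) x -> x \notin p :: s.
  move=> ii' Xu Xu' nu uu' Xs x Hx; apply/negP; rewrite inE => /orP[/eqP xp|].
    subst x; case: Hx => [pu|[/nA//|Fp]]; first by rewrite pu in nu.
    exact: disj (BB _ _ d02) Bp Fp.
  have Bu y : y \in u -> B j0 y by move=> yu; apply: Xu; rewrite inE yu orbT.
  have Bu' y : y \in u' -> B j0 y by move=> yu; apply: Xu'; rewrite inE yu orbT.
  case/Xs => [xu'|[Ax'|Qx]]; case: Hx => [xu|[Ax|Fx]].
  - exact: uu' xu xu'.
  - exact: disj (AB _ _) Ax (Bu' _ xu').
  - exact: disj (BB _ _ d02) (Bu' _ xu') Fx.
  - exact: disj (AB _ _) Ax' (Bu _ xu).
  - exact: disj (AA _ _ ii') Ax Ax'.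
  - exact: disj (AB _ _) Ax' Fx.
  - exact: disj (BB _ _ d01) (Bu _ xu) Qx.
  - exact: disj (AB _ _) Ax Qx.
  - exact: disj (BB _ _ d12) Qx Fx.
have nd (u u' : seq pixel) : {in u, forall x, x \notin u'} ->
    (forall x, x \in u -> x \in u' -> False) /\ (forall x, x \in u' -> x \in u -> False).
  by move=> H; split=> x xu xu'; [have := H _ xu|have := H _ xu']; rewrite ?xu' ?xu.
have [n12' n21'] := nd _ _ n12; have [n13' n31'] := nd _ _ n13.
have [n23' n32'] := nd _ _ n23.
have [i10 _ i21] : [/\ i1 != i0, i2 != i0 & i2 != i1].
  by rewrite i20 ![_ == i0]eq_sym (eq_sym i2) i01 i12.
apply: (theta_pixel ps1 ps2 ps3 s10 s20 s30 _ _ ns1 ns2 ns3 pt1 pt2 pt3 lt1 lt2 lt3).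
- by rewrite ls1.
- by rewrite ls2.
- by move=> x /Xt1 Hx; split; [apply: (sep i0 i1 u1 u2)|apply: (sep i0 i2 u1 u3)].
- by move=> x /Xt2 Hx; split; [apply: (sep i1 i0 u2 u1)|apply: (sep i1 i2 u2 u3)].
- by move=> x /Xt3 Hx; split; [apply: (sep i2 i0 u3 u1)|apply: (sep i2 i1 u3 u2)].
Qed.

(** * Discretization of plane continua *)

(* Adjacency is replaced by connectors [L i j] that intersect both ends, since
   this is the kind of incidence that discretization preserves. *)
Theorem K33_pixel_links (I J : finType) (B : J -> set pixel) (C : I -> set pixel)
    (L : I -> J -> set pixel) :
  (2 < #|I|)%N -> (2 < #|J|)%N ->
  (forall j, walk_connected pixel_adj (B j)) -> (forall i, walk_connected pixel_adj (C i)) ->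
  (forall i j, walk_connected pixel_adj (L i j)) ->
  (forall j j', j != j' -> B j `&` B j' = set0) ->
  (forall i j, C i `&` B j = set0) ->
  (forall i j j', j != j' -> L i j `&` B j' = set0) ->
  (forall i i', i != i' -> C i `&` C i' = set0) ->
  (forall i i' j, i != i' -> C i `&` L i' j = set0) ->
  (forall i i' j j', i != i' -> L i j `&` L i' j' = set0) ->
  (forall i j, L i j `&` C i !=set0) -> (forall i j, L i j `&` B j !=set0) ->
  False.
Proof.
move=> I3 J3 Bc Cc Lc BB CB LB CC CL LL LC LBj.
(* Removing the sets [B j] may break [E i] apart; [A i] is the piece of the remainder that contains
   [C i]. *)
pose E i := C i `|` \bigcup_j L i j.
pose Y i := E i `\` \bigcup_j B j.
pose A i : set pixel := [set x | exists2 c, C i c & linked pixel_adj (Y i) c x].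
have disj (X X' : set pixel) x : X `&` X' = set0 -> X x -> X' x -> False.
  by move=> XY Xx Yx; have : set0 x by rewrite -XY.
have CY i : C i `<=` Y i.
  by move=> c Cic; split; [left|move=> [j _]; apply: disj (CB i j) Cic].
have CA i : C i `<=` A i by move=> c Cic; exists c => //; apply/linked_refl/CY.
have AY i : A i `<=` Y i by move=> x [c _ cx]; have [] := linked_end cx.
have AC i x c : C i c -> linked pixel_adj (Y i) c x -> linked pixel_adj (A i) c x.
  move=> Cic [s [ps ls Xs]]; exists s; split => // z zs; exists c => //.
  case/splitPl: zs ps Xs {ls} => s1 s2 ls1; rewrite cat_path => /andP[ps1 _] Xs.
  by exists s1; split => // y ys; apply: Xs; rewrite -cat_cons mem_cat ys.
apply: (@K33_pixel I J A B) => //.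
- move=> i p q [c Cic cp] [d Cid dq].
  apply: linked_trans (linked_sym pixel_adj_sym (AC _ _ _ Cic cp)) _.
  apply: linked_trans (AC _ _ _ Cid dq).
  exact: linked_sub (CA i) (Cc _ _ _ Cic Cid).
- move=> i i' ii'; apply/seteqP; split=> // x [/AY[Ex _] /AY[Ex' _]].
  case: Ex Ex' => [Cx|[j _ Lx]] [Cx'|[j' _ Lx']].
  + exact: disj (CC _ _ ii') Cx Cx'.
  + exact: disj (CL _ _ _ ii') Cx Lx'.
  + by rewrite eq_sym in ii'; exact: disj (CL _ _ _ ii') Cx' Lx.
  + exact: disj (LL _ _ _ _ ii') Lx Lx'.
- by move=> i j; apply/seteqP; split=> // x [/AY[_ nB] Bx]; apply: nB; exists j.
- move=> i j; have [c [Lic Cic]] := LC i j; have [b [Lib Bjb]] := LBj i j.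
  have [s [ps ls Xs]] := Lc _ _ _ _ Lib Lic.
  (* The connector is cut at its last visit to [B j]. What follows avoids every [B j'] and reaches
     [C i] inside [Y i], so its first pixel is in [A i]. *)
  have [p [u [/asboolP Bp pu lu nu us]]] :=
    @last_exit [pred x | `[< B j x >]] b s (introT (asboolP _) Bjb) ps.
  case: u pu lu nu us => [|a u] /=.
    by move=> _ pc; rewrite -ls -pc in Cic; case: (disj _ _ _ (CB i j) Cic Bp).
  move=> /andP[pa au] lu nu us; exists a, p; split => //; last by rewrite pixel_adj_sym.
  exists c => //; apply: (linked_sym pixel_adj_sym); exists u; split => //; first by rewrite lu ls.
  move=> x xu; have Lx : L i j x by apply: Xs; rewrite inE us ?orbT.
  split; first by right; exists j.
  move=> [j' _ B'x]; have [jj'|jj'] := eqVneq j j'.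
    by have /asboolP := nu x xu; rewrite jj'.
  exact: disj (LB _ _ _ jj') Lx B'x.
Qed.

Section Discretization.
Variable R : realType.
Implicit Types (X Y : set (plane R)) (n : R).

(* The points near a given pixel form an open set, and the pixels near a given
   point form a block of at most 2 x 2, which is connected by sides; rounding
   down instead would only give pixels that share a corner. *)
Definition near_pixel n (x : plane R) (c : pixel) : Prop :=
  `|n * x.1 - c.1%:~R| < 1 /\ `|n * x.2 - c.2%:~R| < 1.

Definition discretize n X : set pixel := [set c | exists2 x, X x & near_pixel n x c].

Lemma near_pixel_open n c : open [set x | near_pixel n x c].
Proof.
have cont1 : continuous (fun x : plane R => n * x.1 - c.1%:~R).
  move=> x; apply: cvgB; last exact: cvg_cst.
  by apply: cvgM; [exact: cvg_cst|exact: cvg_fst].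
have cont2 : continuous (fun x : plane R => n * x.2 - c.2%:~R).
  move=> x; apply: cvgB; last exact: cvg_cst.
  by apply: cvgM; [exact: cvg_cst|exact: cvg_snd].
apply: openI.
  apply: (@open_comp _ _ (fun x : plane R => `|n * x.1 - c.1%:~R|) [set r | r < 1]).
    move=> x _; apply: cvg_norm; exact: cont1.
  exact: open_lt.
apply: (@open_comp _ _ (fun x : plane R => `|n * x.2 - c.2%:~R|) [set r | r < 1]).
  move=> x _; apply: cvg_norm; exact: cont2.
exact: open_lt.
Qed.

Lemma near_pixel_ex n x : exists c, near_pixel n x c.
Proof.
have fl (r : R) : `|r - (Num.floor r)%:~R| < 1.
  have := Num.Theory.floor_le r; have := Num.Theory.floorD1_gt r.
  rewrite intrD => h1 h2; rewrite ltr_norml; lra.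
by exists (Num.floor (n * x.1), Num.floor (n * x.2)); split; apply: fl.
Qed.

Lemma near_pixel_linked n X x c d : X x -> near_pixel n x c -> near_pixel n x d ->
  linked pixel_adj (discretize n X) c d.
Proof.
move=> Xx; case: c d => [c1 c2] [d1 d2] [/= xc1 xc2] [/= xd1 xd2].
have close (a : R) (u v : int) : `|a - u%:~R| < 1 -> `|a - v%:~R| < 1 ->
    u = v \/ `|u - v| = 1.
  rewrite !ltr_norml => au av.
  have : (u - v)%:~R < 2 :> R by rewrite intrB; lra.
  have : (v - u)%:~R < 2 :> R by rewrite intrB; lra.
  rewrite -[2]/(2%:~R) !ltr_int; lia.
apply: (@linked_trans _ _ _ _ (d1, c2)).
  have [->|cd] := close _ _ _ xc1 xd1.
    by apply: linked_refl; exists x.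
  apply: linked_step; try by exists x.
  by rewrite /pixel_adj /= eqxx cd /= orbT.
have [->|cd] := close _ _ _ xc2 xd2.
  by apply: linked_refl; exists x.
apply: linked_step; try by exists x.
by rewrite /pixel_adj /= eqxx cd.
Qed.

Lemma connected_open_cover (T : topologicalType) (X U V : set T) :
  connected X -> open U -> open V -> X `<=` U `|` V -> X `&` U `&` V = set0 ->
  X `&` U !=set0 -> X `<=` U.
Proof.
move=> Xc Uo Vo XUV XUV0 XU; apply/setIidPl.
apply: Xc => //; first by exists U.
exists (~` V); first exact: open_closedC.
apply/seteqP; split=> x [Xx]; first by move=> Ux; split => // Vx; suff : set0 x by []; rewrite -XUV0.
by move=> nV; split => //; case: (XUV _ Xx).
Qed.

(** The points near some pixel linked to [p] and the points near some other pixel form two open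
    sets. They cover [X] and, by [near_pixel_linked], share no point of [X], so connectedness leaves
    only the first. *)
Lemma discretize_connected n X : connected X -> walk_connected pixel_adj (discretize n X).
Proof.
move=> Xc p q [x Xx xp] [y Xy yq].
pose U := \bigcup_(c in linked pixel_adj (discretize n X) p) [set x | near_pixel n x c].
pose V := \bigcup_(c in ~` linked pixel_adj (discretize n X) p) [set x | near_pixel n x c].
have XU : X `<=` U.
  apply: (@connected_open_cover _ X U V) => //.
  - by apply: bigcup_open => c _; exact: near_pixel_open.
  - by apply: bigcup_open => c _; exact: near_pixel_open.
  - move=> z Xz; have [c zc] := near_pixel_ex n z.
    by have [pc|pc] := pselect (linked pixel_adj (discretize n X) p c); [left|right]; exists c.
  - apply/seteqP; split => // z [[Xz [c pc zc]] [d pd zd]]; apply: pd.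
    exact: linked_trans pc (near_pixel_linked Xz zc zd).
  - by exists x; split => //; exists p => //; apply: linked_refl; exists x.
have [c pc yc] := XU _ Xy.
exact: linked_trans pc (near_pixel_linked Xy yc yq).
Qed.

Lemma discretize_meet n X Y : X `&` Y !=set0 -> discretize n X `&` discretize n Y !=set0.
Proof.
move=> [x [Xx Yx]]; have [c xc] := near_pixel_ex n x.
by exists c; split; exists x.
Qed.

Lemma compact_separation X Y : compact X -> compact Y -> X `&` Y = set0 ->
  exists2 e : R, 0 < e & forall x y, X x -> Y y -> e <= `|x - y|.
Proof.
move=> Xc Yc XY; pose Z := (fun z : plane R * plane R => z.1 - z.2) @` (X `*` Y).
have Zc : compact Z.
  apply: continuous_compact; last exact: compact_setX.
  apply: continuous_subspaceT => z.
  by apply: cvgB; [exact: cvg_fst|exact: cvg_snd].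
have Zcl : closed Z by apply: compact_closed => //; exact: norm_hausdorff.
have Z0 : (~` Z) 0.
  move=> [[x y] [/= Xx Yy]] /eqP; rewrite subr_eq0 => /eqP xy.
  by suff : set0 x by []; rewrite -XY; split => //; rewrite xy.
have /nbhs_normP[e /= e0 eZ] : nbhs (0 : plane R) (~` Z).
  by apply: open_nbhs_nbhs; split => //; exact: closed_openC.
exists e => // x y Xx Yy; rewrite leNgt; apply/negP => xy.
apply: (eZ (x - y)); last by exists (x, y).
by rewrite /= sub0r normrN.
Qed.

Lemma discretize_disjoint X Y : compact X -> compact Y -> X `&` Y = set0 ->
  \forall n \near +oo, discretize n X `&` discretize n Y = set0.
Proof.
move=> Xc Yc XY; have [e e0 eXY] := compact_separation Xc Yc XY.
near=> n; apply/seteqP; split => // -[c1 c2] [[x Xx [/= xc1 xc2]] [y Yy [/= yc1 yc2]]].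
have n0 : 0 < n by near: n; apply: nbhs_pinfty_gt; rewrite num_real.
(* Two points near the same pixel differ by less than [2 / n] in each coordinate. *)
have ne : 2 < n * e.
  by rewrite -ltr_pdivrMr //; near: n; apply: nbhs_pinfty_gt; rewrite num_real.
have close (a b u : R) : `|n * a - u| < 1 -> `|n * b - u| < 1 -> `|a - b| < e.
  move=> au bu; rewrite -(ltr_pM2l n0); apply: lt_trans ne.
  have -> : n * `|a - b| = `|n * a - n * b| by rewrite -mulrBr normrM gtr0_norm.
  move: au bu; rewrite !ltr_norml; lra.
have := eXY _ _ Xx Yy; rewrite leNgt => /negP; apply.
rewrite prod_normE /= gt_max.
by rewrite (close _ _ _ xc1 yc1) (close _ _ _ xc2 yc2).
Unshelve. all: by end_near.
Qed.

(** Connectedness and incidence pass to every scale, and each of the finitely many disjointness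
    conditions holds at all large scales; so one scale serves for all of them. *)
Theorem K33_plane_links (I J : finType) (B : J -> set (plane R))
    (C : I -> set (plane R)) (L : I -> J -> set (plane R)) :
  (2 < #|I|)%N -> (2 < #|J|)%N ->
  (forall j, compact (B j) /\ connected (B j)) ->
  (forall i, compact (C i) /\ connected (C i)) ->
  (forall i j, compact (L i j) /\ connected (L i j)) ->
  (forall j j', j != j' -> B j `&` B j' = set0) ->
  (forall i j, C i `&` B j = set0) ->
  (forall i j j', j != j' -> L i j `&` B j' = set0) ->
  (forall i i', i != i' -> C i `&` C i' = set0) ->
  (forall i i' j, i != i' -> C i `&` L i' j = set0) ->
  (forall i i' j j', i != i' -> L i j `&` L i' j' = set0) ->
  (forall i j, L i j `&` C i !=set0) -> (forall i j, L i j `&` B j !=set0) ->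
  False.
Proof.
move=> I3 J3 Bc Cc Lc BB CB LB CC CL LL LC LBj.
have dC (X : set (plane R)) (n : R) : compact X /\ connected X -> walk_connected pixel_adj (discretize n X).
  by case=> _; apply: discretize_connected.
have dD (T : finType) (P : T -> Prop) (X Y : T -> set (plane R)) :
    (forall i, compact (X i)) -> (forall i, compact (Y i)) ->
    (forall i, P i -> X i `&` Y i = set0) ->
    \forall n \near +oo, forall i, P i -> discretize n (X i) `&` discretize n (Y i) = set0.
  move=> Xc Yc XY; apply: filter_forall => i.
  have [Pi|nP] := pselect (P i); last by apply: nearW => n /nP.
  by near=> n => _; near: n; apply: discretize_disjoint => //; apply: XY.
have Bk j : compact (B j) by case: (Bc j).
have Ck j : compact (C j) by case: (Cc j).
have Lk i j : compact (L i j) by case: (Lc i j).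
have : \forall n \near (+oo : set_system R), False; last by move=> /filter_ex[].
near=> n.
apply: (@K33_pixel_links I J (fun j => discretize n (B j)) (fun j => discretize n (C j))
  (fun i j => discretize n (L i j))).
- exact: I3.
- exact: J3.
- by move=> j; apply: dC.
- by move=> j; apply: dC.
- by move=> i j; apply: dC.
- suff H : forall t : J * J, t.1 != t.2 ->
      discretize n (B t.1) `&` discretize n (B t.2) = set0.
    by move=> j j'; apply: (H (j, j')).
  by near: n; apply: (dD (J * J)%type) => // -[] /=; auto.
- suff H : forall t : I * J, true -> discretize n (C t.1) `&` discretize n (B t.2) = set0.
    by move=> i j; apply: (H (i, j)).
  by near: n; apply: (dD (I * J)%type) => // -[] /=; auto.
- suff H : forall t : I * J * (J * J), t.1.2 != t.2.1 ->
      discretize n (L t.1.1 t.1.2) `&` discretize n (B t.2.1) = set0.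
    by move=> i j j'; apply: (H ((i, j), (j', j'))).
  by near: n; apply: (dD (I * J * (J * J))%type) => // -[[i j] [j' k]] /=; auto.
- suff H : forall t : I * I, t.1 != t.2 ->
      discretize n (C t.1) `&` discretize n (C t.2) = set0.
    by move=> j j'; apply: (H (j, j')).
  by near: n; apply: (dD (I * I)%type) => // -[] /=; auto.
- suff H : forall t : I * I * (J * J), t.1.1 != t.1.2 ->
      discretize n (C t.1.1) `&` discretize n (L t.1.2 t.2.1) = set0.
    by move=> i i' j; apply: (H ((i, i'), (j, j))).
  by near: n; apply: (dD (I * I * (J * J))%type) => // -[[i j] [j' k]] /=; auto.
- suff H : forall t : I * I * (J * J), t.1.1 != t.1.2 ->
      discretize n (L t.1.1 t.2.1) `&` discretize n (L t.1.2 t.2.2) = set0.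
    by move=> i i' j j'; apply: (H ((i, i'), (j, j'))).
  by near: n; apply: (dD (I * I * (J * J))%type) => // -[[i j] [j' k]] /=; auto.
- by move=> i j; apply: discretize_meet.
- by move=> i j; apply: discretize_meet.
Unshelve. all: by end_near.
Qed.

End Discretization.

(** * Arcs and continua in the plane *)

Section PlaneTopology.
Variable R : realType.
Implicit Types (p q x y : plane R) (A X : set (plane R)).

Lemma compact_bigcup_fin (T : topologicalType) (I : finType) (X : I -> set T) (P : set I) :
  (forall i, P i -> compact (X i)) -> compact (\bigcup_(i in P) X i).
Proof.
move=> Xc; rewrite (_ : \bigcup_(i in P) X i = \big[setU/set0]_(i <- enum I | `[< P i >]) X i).
  by apply: bigsetU_compact => i /asboolP; apply: Xc.
rewrite -bigcup_seq_cond; apply: eq_bigcupl; split=> i /=.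
  by move=> Pi; rewrite mem_enum /=; apply/asboolP.
by case/andP => _ /asboolP.
Qed.

Lemma continuous_interval_image (f : R -> plane R) (J J' : interval R) :
  {within [set` J], continuous f} -> [set` J'] `<=` [set` J] ->
  connected (f @` [set` J']).
Proof.
move=> fc JJ; apply: connected_continuous_connected.
  exact/connected_intervalP/interval_is_interval.
exact: continuous_subspaceW fc.
Qed.

(** Halving disentangles edges with a common end: the halves at that end are merged into one star,
    and the other halves become connectors. *)
Lemma arc_split p q A : is_arc p q A -> exists H : set (plane R) * set (plane R),
  [/\ compact H.1 /\ connected H.1, compact H.2 /\ connected H.2,
      A = H.1 `|` H.2, H.1 `&` H.2 !=set0 &
      [/\ H.1 p, H.2 q, ~ H.1 q & ~ H.2 p]].
Proof.
move=> [g [gc gi g0 g1 <-]].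
have sub1 : `[0, 2^-1] `<=` `[0, 1 : R].
  by move=> t; rewrite /= !in_itv /=; lra.
have sub2 : `[2^-1, 1] `<=` `[0, 1 : R].
  by move=> t; rewrite /= !in_itv /=; lra.
exists (g @` `[0, 2^-1], g @` `[2^-1, 1]); split => /=.
- split; last exact: continuous_interval_image gc sub1.
  apply: continuous_compact; last exact: segment_compact.
  exact: continuous_subspaceW gc.
- split; last exact: continuous_interval_image gc sub2.
  apply: continuous_compact; last exact: segment_compact.
  exact: continuous_subspaceW gc.
- rewrite -image_setU; congr (_ @` _); apply/seteqP; split=> t /=.
    rewrite !in_itv /= => /andP[t0 t1].
    by have [th|th] := leP t 2^-1; [left|right]; apply/andP; split => //; exact: ltW.
  by case=> [/sub1|/sub2].
- by exists (g 2^-1); split; exists 2^-1 => //=; rewrite ?in_itv /=; lra.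
- split.
  + by exists 0 => //=; rewrite ?in_itv /=; lra.
  + by exists 1 => //=; rewrite ?in_itv /=; lra.
  + move=> [t t01]; rewrite -g1 => /gi => /(_ (mem_set (sub1 _ t01))).
    have one : 1 \in `[0, 1 : R]%classic by rewrite inE /= in_itv /=; lra.
    by move=> /(_ one) t1; move: t01; rewrite t1 /= in_itv /=; lra.
  + move=> [t t01]; rewrite -g0 => /gi => /(_ (mem_set (sub2 _ t01))).
    have one : 0 \in `[0, 1 : R]%classic by rewrite inE /= in_itv /=; lra.
    by move=> /(_ one) t1; move: t01; rewrite t1 /= in_itv /=; lra.
Qed.

Lemma arc_compact_connected p q A : is_arc p q A ->
  [/\ compact A, connected A, A p & A q].
Proof.
move=> /arc_split[H [[H1 H1'] [H2 H2'] -> HH [Hp Hq _ _]]]; split; [| |by left|by right].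
- exact: compactU.
- exact: connectedU.
Qed.

(** This carries the outer face along an edge up to its far end [q], which may itself lie on the
    drawing. *)
Lemma arc_tail p q A : is_arc p q A -> p <> q ->
  connected (A `\ q) /\ closure (A `\ q) q.
Proof.
move=> arcA pq; have [_ Ac Ap Aq] := arc_compact_connected arcA; split.
  case: arcA => g [gc gi g0 g1 gA].
  have sub : `[0, 1[ `<=` `[0, 1 : R] by move=> t; rewrite /= !in_itv /=; lra.
  rewrite (_ : A `\ q = g @` `[0, 1[); first exact: continuous_interval_image gc sub.
  apply/seteqP; split=> z.
    rewrite -gA => -[[t t01 <-] tq]; exists t => //.
    move: t01; rewrite /= !in_itv /= => /andP[-> t1]; rewrite lt_neqAle t1 andbT.
    by apply/eqP => t1'; apply: tq; rewrite t1' g1.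
  move=> [t t01 <-]; split; first by rewrite -gA; exists t => //; apply: sub.
  rewrite -g1 => /gi => /(_ (mem_set (sub _ t01))).
  have one : 1 \in `[0, 1 : R]%classic by rewrite inE /= in_itv /=; lra.
  by move=> /(_ one) t1; move: t01; rewrite t1 /= in_itv /=; lra.
(* Otherwise [q] would be an isolated point of the connected set [A], which also contains [p]. *)
apply: contrapT => ncl.
suff : A `<=` ~` closure (A `\ q).
  by move=> /(_ _ Ap); apply; apply: subset_closure.
apply: (@connected_open_cover _ A _ (~` [set q])) => //.
- exact/closed_openC/closed_closure.
- apply: closed_openC; apply: compact_closed; last exact: compact_set1.
  exact: (@norm_hausdorff R (plane R)).
- by move=> z Az; have [->|zq] := pselect (z = q); [left|right].
- by apply/seteqP; split=> // z [[Az ncz] zq]; apply: ncz; apply: subset_closure.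
- by exists q.
Qed.

Definition segment p q : set (plane R) := (fun t : R => p + t *: (q - p)) @` `[0, 1].

Lemma segment_continuum p q :
  [/\ compact (segment p q), connected (segment p q), segment p q p & segment p q q].
Proof.
have fc : continuous (fun t : R => p + t *: (q - p)).
  by move=> t; apply: cvgD; [exact: cvg_cst|apply: cvgZ; [exact: cvg_id|exact: cvg_cst]].
split.
- apply: continuous_compact; last exact: segment_compact.
  exact: continuous_subspaceT.
- by apply: (@continuous_interval_image _ `[0, 1] `[0, 1]) => //; exact: continuous_subspaceT.
- by exists 0; rewrite /= ?in_itv /= ?scale0r ?addr0 //; lra.
- by exists 1; rewrite /= ?in_itv /= ?scale1r ?subrKC //; lra.
Qed.

Lemma convex_connected X : (forall p q, X p -> X q -> segment p q `<=` X) -> connected X.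
Proof.
move=> Xconv; have [->|/set0P[p Xp]] := eqVneq X set0; first exact: connected0.
rewrite (_ : X = \bigcup_(q in X) segment p q).
  apply: bigcup_connected.
    by exists p => q Xq; have [] := segment_continuum p q.
  by move=> q Xq; have [] := segment_continuum p q.
apply/seteqP; split=> [q Xq|z [q Xq]]; last exact: Xconv.
by exists q => //; have [] := segment_continuum p q.
Qed.

Lemma segment_ball p q e x : `|x - p| < e -> `|x - q| < e ->
  segment p q `<=` [set y | `|x - y| < e].
Proof.
move=> xp xq _ [t + <-]; rewrite /= in_itv /= => /andP[t0 t1].
have -> : x - (p + t *: (q - p)) = (1 - t) *: (x - p) + t *: (x - q).
    rewrite scalerBl scale1r !scalerBr opprD opprB [in RHS]opprB !addrA.
  by rewrite subrK.
apply: le_lt_trans (ler_normD _ _) _; rewrite !normrZ !ger0_norm ?subr_ge0 //.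
have [->|t0'] := eqVneq t 0; first by rewrite subr0 mul1r mul0r addr0.
have lt1 : t * `|x - q| < t * e by rewrite ltr_pM2l // lt_def t0'.
have lt2 : (1 - t) * `|x - p| <= (1 - t) * e by rewrite ler_wpM2l ?subr_ge0 // ltW.
by have := ltr_leD lt1 lt2; rewrite -mulrDl addrC subrKC mul1r addrC.
Qed.

Lemma open_ball_sub (F : set (plane R)) x : open F -> F x ->
  exists2 e : R, 0 < e & forall y, `|x - y| < e -> F y.
Proof.
move=> Fo Fx; have /nbhs_normP[e /= e0 eF] := open_nbhs_nbhs (conj Fo Fx).
by exists e => // y xy; apply: eF.
Qed.

Lemma nbhs_plane x e (P : set (plane R)) : 0 < e ->
  (forall y, `|x - y| < e -> P y) -> nbhs x P.
Proof. by move=> e0 eP; rewrite -(@nbhs_nbhs_norm R (plane R)); exists e. Qed.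

Lemma closure_near (F : set (plane R)) x e : closure F x -> 0 < e ->
  exists2 y, F y & `|x - y| < e.
Proof.
move=> /(_ [set y | `|x - y| < e]) cF e0; case: cF => [|y [Fy xy]]; last by exists y.
exact: nbhs_plane e0 _.
Qed.

(** Segments in small balls extend a continuum that starts at [x], so the points reached form an
    open subset of [F] whose complement in [F] is open. Applied to the outer face, which is not
    compact, it gives a compact substitute. *)
Lemma open_connected_continuum (F : set (plane R)) x y : open F -> connected F ->
  F x -> F y -> exists K, [/\ compact K, connected K, K `<=` F, K x & K y].
Proof.
move=> Fo Fc Fx Fy.
pose U : set (plane R) := [set z | exists K, [/\ compact K, connected K, K `<=` F, K x & K z]].
have UF : U `<=` F by move=> z [K [_ _ KF _ Kz]]; apply: KF.
have ext z w : U z -> segment z w `<=` F -> U w.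
  move=> [K [Kk Kc KF Kx Kz]] sF; have [sk sc sz sw] := segment_continuum z w.
  exists (K `|` segment z w); split; [exact: compactU| |by rewrite subUset|by left|by right].
  by apply: connectedU => //; exists z.
have segF z w v e : (forall y, `|v - y| < e -> F y) -> `|v - z| < e -> `|v - w| < e ->
    segment z w `<=` F.
  by move=> eF vz vw t /(segment_ball vz vw) /eF.
suff : F `<=` U by apply.
apply: (@connected_open_cover _ F U (F `\` U)) => //.
- rewrite openE => z Uz; have [e e0 eF] := open_ball_sub Fo (UF _ Uz).
  apply: (nbhs_plane e0) => w zw; apply: ext Uz _.
  by apply: segF eF _ zw; rewrite subrr normr0.
- rewrite openE => z [Fz nUz]; have [e e0 eF] := open_ball_sub Fo Fz.
  apply: (nbhs_plane e0) => w zw; split; first exact: eF.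
  move=> Uw; apply: nUz; apply: ext Uw _.
  by apply: segF eF zw _; rewrite subrr normr0.
- by move=> z Fz; have [Uz|Uz] := pselect (U z); [left|right].
- by apply/seteqP; split => // z [[_ Uz] [_]].
- exists x; split => //; exists [set x]; split => //.
  + exact: compact_set1.
  + exact: connected1.
  + by move=> _ ->.
Qed.

Lemma open_component (F : set (plane R)) x : open F -> open (connected_component F x).
Proof.
move=> Fo; rewrite openE => y Cy.
have [e e0 eF] := open_ball_sub Fo (connected_component_sub Cy).
apply: (nbhs_plane e0) => z yz.
apply: connected_component_trans Cy _.
have [sk sc sy sz] := segment_continuum y z.
exists (segment y z) => //; split => //.
by move=> t /segment_ball H; apply: eF; apply: H => //; rewrite subrr normr0.
Qed.

Lemma halfplane_connected (f : plane R -> R) (M : R) :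
  (forall t p q, f (p + t *: (q - p)) = f p + t * (f q - f p)) ->
  connected [set p | M < f p].
Proof.
move=> fa; apply: convex_connected => p q /= Mp Mq _ [t + <-].
rewrite /= in_itv /= fa => /andP[t0 t1].
have [->|t1'] := eqVneq t 1; first by rewrite mul1r subrKC.
have lt1 : 0 < (1 - t) * (f p - M) by rewrite mulr_gt0 ?subr_gt0 // lt_neqAle t1'.
have le2 : 0 <= t * (f q - M) by rewrite mulr_ge0 ?subr_ge0 // ltW.
rewrite (_ : _ + _ = (1 - t) * (f p - M) + t * (f q - M) + M); last by ring.
by rewrite ltrDr ltr_wpDr.
Qed.

Lemma line_fst p q (t : R) : (p + t *: (q - p)).1 = p.1 + t * (q.1 - p.1).
Proof. by []. Qed.

Lemma line_snd p q (t : R) : (p + t *: (q - p)).2 = p.2 + t * (q.2 - p.2).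
Proof. by []. Qed.

(** In the sup norm, the outside of a ball is the union of four open half-planes, which overlap one
    after the other. *)
Lemma outside_connected (M : R) : connected [set p : plane R | M < `|p|].
Proof.
pose f1 (p : plane R) := p.1; pose f2 (p : plane R) := p.2.
pose f3 (p : plane R) := - p.1; pose f4 (p : plane R) := - p.2.
pose H (f : plane R -> R) := [set p | M < f p].
have norms (a b : R) : (M < `|(a, b) : plane R|) = [|| M < a, M < b, M < - a | M < - b].
  by rewrite prod_normE /= lt_max !ltr_normr; move: (M < a) (M < b) (M < - a) (M < - b) => [] [] [] [].
rewrite (_ : mkset _ = (H f1 `|` H f2) `|` (H f3 `|` H f4)); last first.
  apply/seteqP; split=> -[a b]; rewrite /H /f1 /f2 /f3 /f4 /= norms.
    by case/or4P => ?; [left; left|left; right|right; left|right; right].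
  by case=> [[]|[]] ->; rewrite ?orbT.
have H1 : connected (H f1) by apply: halfplane_connected => t p q; rewrite /f1 line_fst; ring.
have H2 : connected (H f2) by apply: halfplane_connected => t p q; rewrite /f2 line_snd; ring.
have H3 : connected (H f3) by apply: halfplane_connected => t p q; rewrite /f3 line_fst; ring.
have H4 : connected (H f4) by apply: halfplane_connected => t p q; rewrite /f4 line_snd; ring.
pose m := `|M| + 1.
have mM : M < m by rewrite /m; have := ler_norm M; lra.
apply: connectedU.
- by exists (- m, m); split; [right; exact: mM|left; rewrite /H /f3 /= opprK].
- by apply: connectedU => //; exists (m, m).
- by apply: connectedU => //; exists (- m, - m); rewrite /H /f3 /f4 /= !opprK.
Qed.

End PlaneTopology.

(** * The outer face of a drawing *)

Section Drawing.
Variables (R : realType) (G : sgraph) (E : plane_embedding R G).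
Implicit Types (S : set G) (X : set (plane R)).

Lemma adj_neq (u v : G) : adj u v -> u <> v.
Proof. by move=> uv vu; move: uv; rewrite vu adj_irrefl. Qed.

Lemma drawing_vertex S v : S v -> drawing E S (vertex_pt E v).
Proof. by move=> Sv; left; exists v. Qed.

Lemma drawing_edge S u v : S u -> S v -> adj u v -> edge_arc E u v `<=` drawing E S.
Proof. by move=> Su Sv uv p up; right; exists u, v. Qed.

Lemma drawing_sub S S' : S `<=` S' -> drawing E S `<=` drawing E S'.
Proof.
move=> SS p [[v Sv ->]|[u [v [Su Sv uv puv]]]]; [left|right].
  by exists v => //; apply: SS.
by exists u, v; split => //; apply: SS.
Qed.

Lemma edge_arc_endpoints u v : adj u v ->
  edge_arc E u v (vertex_pt E u) /\ edge_arc E u v (vertex_pt E v).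
Proof. by move=> uv; have [_ _ ? ?] := arc_compact_connected (edge_arcP E uv). Qed.

Lemma drawing_compact S : compact (drawing E S).
Proof.
rewrite (_ : drawing E S = (\bigcup_(v in S) [set vertex_pt E v]) `|`
  \bigcup_(uv in [set uv : G * G | [/\ S uv.1, S uv.2 & adj uv.1 uv.2]]) edge_arc E uv.1 uv.2).
  apply: compactU; first by apply: compact_bigcup_fin => v _; exact: compact_set1.
  apply: compact_bigcup_fin => -[u v] [_ _ uv].
  by have [] := arc_compact_connected (edge_arcP E uv).
apply/seteqP; split=> p.
  by case=> [[v Sv ->]|[u [v [Su Sv uv puv]]]]; [left; exists v|right; exists (u, v)].
case=> [[v Sv ->]|[[u v] [Su Sv uv] puv]]; [left|right].
  by exists v.
by exists u, v.
Qed.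

Lemma drawing_connected S : walk_connected (@adj G) S -> connected (drawing E S).
Proof.
move=> Sc; have [->|/set0P[v0 Sv0]] := eqVneq S set0.
  rewrite (_ : drawing E set0 = set0); first exact: connected0.
  by apply/seteqP; split => // p [[v []]|[u [v [[]]]]].
pose Q (X : set (plane R)) := [/\ connected X, X `<=` drawing E S & X (vertex_pt E v0)].
have reach v : linked (@adj G) S v0 v -> exists2 X, Q X & X (vertex_pt E v).
  move=> [s [ps <- Ss]]; elim/last_ind: s ps Ss => [|s u IH] /=.
    move=> _ _; exists [set vertex_pt E v0] => //; split => //; first exact: connected1.
    by move=> _ ->; apply: drawing_vertex.
  rewrite rcons_path last_rcons => /andP[ps su] Ss.
  have Ss' : {in v0 :: s, forall x, S x}.
    move=> x; rewrite inE => xs; apply: Ss; rewrite inE mem_rcons inE.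
    by case/orP: xs => ->; rewrite ?orbT.
  have [X [Xc XS X0] Xs] := IH ps Ss'.
  have [_ Ac As Au] := arc_compact_connected (edge_arcP E su).
  exists (X `|` edge_arc E (last v0 s) u); last by right.
  split; last by left.
    by apply: connectedU => //; exists (vertex_pt E (last v0 s)).
  rewrite subUset; split => //; apply: drawing_edge => //.
    by apply: Ss'; exact: mem_last.
  by apply: Ss; rewrite inE mem_rcons mem_head orbT.
rewrite (_ : drawing E S = \bigcup_(X in Q) X).
  apply: bigcup_connected; last by move=> X [].
  by exists (vertex_pt E v0) => X [].
apply/seteqP; split=> [p|p [X [_ XS _] /XS]//].
case=> [[v Sv ->]|[u [v [Su Sv uv puv]]]].
  by have [X QX Xv] := reach v (Sc _ _ Sv0 Sv); exists X.
have [X [Xc XS X0] Xu] := reach u (Sc _ _ Sv0 Su).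
have [_ Ac Au _] := arc_compact_connected (edge_arcP E uv).
exists (X `|` edge_arc E u v); last by right.
split; [|by rewrite subUset; split => //; apply: drawing_edge|by left].
by apply: connectedU => //; exists (vertex_pt E u).
Qed.

Lemma drawing_closedC S : open (~` drawing E S).
Proof.
apply: closed_openC; apply: compact_closed; last exact: drawing_compact.
exact: (@norm_hausdorff R (plane R)).
Qed.

Lemma unbounded_outside X (M : R) : ~ bounded_set X -> exists2 p, X p & M < `|p|.
Proof.
move=> nb; apply: contrapT => nX; apply: nb.
exists M; split; first exact: num_real.
move=> N MN p Xp /=; apply: le_trans (ltW MN); rewrite leNgt; apply/negP => Mp.
by apply: nX; exists p.
Qed.

Lemma outside_unbounded (M : R) : ~ bounded_set [set p : plane R | M < `|p|].
Proof.
move=> [N [_ HN]]; set K := Num.max `|M| `|N|.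
have [MK NK] : `|M| <= K /\ `|N| <= K by rewrite !le_max !lexx orbT.
have NN : N <= `|N| by exact: ler_norm.
have MM : M <= `|M| by exact: ler_norm.
have n0 : 0 <= `|M| by [].
have nK : `|((K + 2, 0) : plane R)| = K + 2.
  by rewrite prod_normE /= normr0 ger0_norm; [rewrite max_l //|]; lra.
have := HN (K + 1) _ (K + 2, 0); rewrite /= nK.
have -> : N < K + 1 by lra.
have -> : M < K + 2 by lra.
by move=> /(_ isT isT); lra.
Qed.

(** The drawing is compact, so the connected outside of a large ball lies in one component of the
    complement; every unbounded component contains points of that outside, hence coincides with this
    one. *)
Lemma outer_faceP S : exists w N,
  outer_face E S = connected_component (~` drawing E S) w /\
  [set p : plane R | N < `|p|] `<=` outer_face E S.
Proof.
have /compact_bounded[M [_ HM]] := @drawing_compact S.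
pose N := M + 1; have DM := HM N (ltr_pwDr ltr01 (lexx _)).
have out : [set p : plane R | N < `|p|] `<=` ~` drawing E S.
  by move=> p /= Np Dp; have := DM _ Dp => /=; rewrite leNgt Np.
have [w _ Nw] := unbounded_outside N (@outside_unbounded N).
have outw : [set p : plane R | N < `|p|] `<=` connected_component (~` drawing E S) w.
  by apply: connected_component_max => //; apply: outside_connected.
exists w, N; suff FE : outer_face E S = connected_component (~` drawing E S) w.
  by rewrite FE.
apply/seteqP; split=> p.
  move=> [nDp /(unbounded_outside N)[q pq Nq]].
  apply: connected_component_trans (outw _ Nq) _.
  exact: connected_component_sym.
move=> wp; split; first exact: connected_component_sub wp.
rewrite -(same_connected_component wp) => -[B [Br HB]].
apply: (@outside_unbounded N); exists B; split => // K BK.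
by apply: subset_trans outw _; exact: HB.
Qed.

Lemma outer_face_open S : open (outer_face E S).
Proof. by have [w [_ [-> _]]] := outer_faceP S; exact/open_component/drawing_closedC. Qed.

Lemma outer_face_connected S : connected (outer_face E S).
Proof. by have [w [_ [-> _]]] := outer_faceP S; exact: component_connected. Qed.

Lemma outer_face_sub S : outer_face E S `<=` ~` drawing E S.
Proof. by move=> p []. Qed.

Lemma outer_face_max S X : connected X -> X `<=` ~` drawing E S ->
  X `&` outer_face E S !=set0 -> X `<=` outer_face E S.
Proof.
have [w [_ [-> _]]] := outer_faceP S => Xc XD [p [Xp wp]] q Xq.
by apply: connected_component_trans wp _; exists X.
Qed.

Lemma outer_face_unbounded S X : connected X -> X `<=` ~` drawing E S ->
  ~ bounded_set X -> X `<=` outer_face E S.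
Proof.
move=> Xc XD Xb p Xp; split; first exact: XD.
move=> [B [Br HB]]; apply: Xb; exists B; split => // K BK.
apply: subset_trans (HB K BK).
exact: connected_component_max.
Qed.

(** The outer face of the larger drawing avoids the smaller one and remains connected and unbounded.
    This allows reasoning about a disk alone, whatever else is still present. *)
Lemma outer_face_antimono S S' : S `<=` S' -> outer_face E S' `<=` outer_face E S.
Proof.
move=> SS; apply: outer_face_unbounded.
- exact: outer_face_connected.
- by move=> p [nD _] /(drawing_sub SS).
- have [w [N [_ NF]]] := outer_faceP S' => -[B [Br HB]].
  apply: (@outside_unbounded N); exists B; split => // K BK.
  exact: subset_trans NF (HB K BK).
Qed.

Lemma outer_vertices_antimono S S' : S `<=` S' ->
  outer_vertices E S' `&` S `<=` outer_vertices E S.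
Proof.
move=> SS v [[_ cv] Sv]; split => //; apply: closure_subset cv.
exact: outer_face_antimono.
Qed.

Lemma outer_face_vertex S v : closure (outer_face E S) (vertex_pt E v) ->
  ~ drawing E S (vertex_pt E v) -> outer_face E S (vertex_pt E v).
Proof.
move=> cF nD; have [e e0 eD] := open_ball_sub (@drawing_closedC S) nD.
have [y Fy vy] := closure_near cF e0.
apply: (@outer_face_max S (segment (vertex_pt E v) y)).
- by have [] := segment_continuum (vertex_pt E v) y.
- by move=> t /segment_ball H; apply: eD; apply: H => //; rewrite subrr normr0.
- by exists y; split => //; have [] := segment_continuum (vertex_pt E v) y.
- by have [] := segment_continuum (vertex_pt E v) y.
Qed.

Lemma vertex_notin_drawing S v : ~ S v -> ~ drawing E S (vertex_pt E v).
Proof.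
move=> nS [[u Su /vertex_pt_inj vu]|[u [w [Su Sw uw]]]]; first by apply: nS; rewrite vu.
by move=> /edge_arc_vertex => /(_ uw)[] vw; apply: nS; rewrite vw.
Qed.

Lemma edge_drawing S u v p : adj u v -> ~ S u -> edge_arc E u v p ->
  drawing E S p -> S v /\ p = vertex_pt E v.
Proof.
move=> uv nSu puv [[w Sw pw]|[x [y [Sx Sy xy pxy]]]].
  move: puv; rewrite pw => /(edge_arc_vertex uv)[wu|wv]; first by rewrite wu in Sw.
  by rewrite -wv.
have n1 : (u, v) <> (x, y) by move=> [ux _]; rewrite -ux in Sx.
have n2 : (u, v) <> (y, x) by move=> [uy _]; rewrite -uy in Sy.
have [w [-> wuv wxy]] := edge_arc_cross uv xy n1 n2 puv pxy.
have Sw : S w by case: wxy => ->.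
by case: wuv => wE; rewrite wE in Sw *.
Qed.

(** Up to its far end the arc avoids the drawing of [S], so it stays in the face where it starts. *)
Lemma outer_face_edge S u v : adj u v -> ~ S u -> outer_face E S (vertex_pt E u) ->
  closure (outer_face E S) (vertex_pt E v) /\
  (~ S v -> outer_face E S (vertex_pt E v)).
Proof.
move=> uv nSu Fu; have [eu ev] := edge_arc_endpoints uv.
have puv : vertex_pt E u <> vertex_pt E v by move=> /vertex_pt_inj; exact: adj_neq.
have [Ac Acl] := arc_tail (edge_arcP E uv) puv.
have AF : edge_arc E u v `\ vertex_pt E v `<=` outer_face E S.
  apply: outer_face_max => //; last by exists (vertex_pt E u).
  by move=> p [puv' pv] /(edge_drawing uv nSu puv')[].
have cv : closure (outer_face E S) (vertex_pt E v) by apply: closure_subset Acl.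
split=> // nSv; apply: outer_face_vertex => //; exact: vertex_notin_drawing.
Qed.

Lemma outer_face_linked S u v : linked (@adj G) (~` S) u v ->
  outer_face E S (vertex_pt E u) -> outer_face E S (vertex_pt E v).
Proof.
move=> [s [ps <- Ss]]; elim: s u ps Ss => //= w s IH u /andP[uw ws] Ss Fu.
apply: IH ws _ _ => [x xs|]; first by apply: Ss; rewrite inE xs orbT.
have [_] := outer_face_edge uw (Ss _ (mem_head _ _)) Fu; apply.
by apply: Ss; rewrite !inE eqxx orbT.
Qed.

End Drawing.

(** * The outer face as one vertex of a K33 *)

Section EmbeddingK33.
Variables (R : realType) (G : sgraph) (E : plane_embedding R G) (S : set G).
Variables (I : finType) (V : I -> set G) (b : bool -> G) (t : I -> bool -> G) (y : I -> G).
Hypotheses (I3 : (2 < #|I|)%N) (VS : forall i, V i `<=` S) (bS : forall j, S (b j)).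
Hypotheses (b_neq : b true <> b false) (bV : forall i j, ~ V i (b j)).
Hypothesis VV : forall i i', i != i' -> V i `&` V i' = set0.
Hypothesis Vc : forall i, walk_connected (@adj G) (V i).
Hypotheses (tV : forall i j, V i (t i j)) (bt : forall i j, adj (b j) (t i j)).
Hypotheses (yV : forall i, V i (y i)).
Hypothesis yF : forall i, closure (outer_face E S) (vertex_pt E (y i)).

Local Notation pt := (vertex_pt E).
Local Notation edge i j := (edge_arc E (b j) (t i j)).

Let V_disj i i' v : i != i' -> V i v -> V i' v -> False.
Proof. by move=> ii' Vv V'v; suff : set0 v by []; rewrite -(VV ii'). Qed.

Let b_inj j j' : b j = b j' -> j = j'.
Proof. by case: j j' => [] [] // bb; case: b_neq. Qed.

Let edge_drawing_V i j i' p : edge i j p -> drawing E (V i') p -> i = i' /\ p = pt (t i j).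
Proof.
move=> ep Dp; have [Vt ->] := edge_drawing (bt i j) (@bV i' j) ep Dp; split => //.
by apply/eqP/negPn/negP => ii'; apply: V_disj ii' (tV i j) Vt.
Qed.

Let edge_edge i j i' j' p : edge i j p -> edge i' j' p -> (i, j) != (i', j') ->
  (i = i' /\ p = pt (t i j)) \/ (j = j' /\ p = pt (b j)).
Proof.
move=> ep ep' nij.
have n1 : (b j, t i j) <> (b j', t i' j').
  move=> [/b_inj jj' tt]; subst j'; case/eqP: nij; congr pair.
  apply/eqP/negPn/negP => ii'; apply: V_disj ii' (tV i j) _; rewrite tt; exact: tV.
have n2 : (b j, t i j) <> (t i' j', b j').
  by move=> [bt' _]; apply: (@bV i' j); rewrite bt'.
have [w [-> w1 w2]] := edge_arc_cross (bt i j) (bt i' j') n1 n2 ep ep'.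
case: w1 => wE; case: w2 => wE'; subst w.
- by right; split => //; apply: b_inj.
- by exfalso; apply: (@bV i' j); rewrite wE'.
- by exfalso; apply: (@bV i j'); rewrite -wE'.
- left; split => //; apply/eqP/negPn/negP => ii'.
  by apply: V_disj ii' (tV i j) _; rewrite wE'.
Qed.

Let drawing_V_disj i i' p : i != i' -> drawing E (V i) p -> drawing E (V i') p -> False.
Proof.
move=> ii' [[v Vv ->]|[u [v [Vu Vv uv puv]]]] Dp.
  by apply: (vertex_notin_drawing _ Dp) => V'v; exact: V_disj ii' Vv V'v.
have nu : ~ V i' u by move=> V'u; exact: V_disj ii' Vu V'u.
by have [V'v _] := edge_drawing uv nu puv Dp; exact: V_disj ii' Vv V'v.
Qed.

Let F := outer_face E S.

Let F_drawing p : F p -> drawing E S p -> False.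
Proof. by move=> /outer_face_sub nD Dp. Qed.

(** One side consists of the drawings of the sets [V i]; the other, of the two stars of half-edges
    at the [b j] and a continuum inside the outer face. The connectors are the remaining half-edges
    and short segments from the [y i] into the outer face. *)
Lemma embedding_no_K33 : False.
Proof.
have /choice[H0 H0P] : forall ij : I * bool, exists H : set (plane R) * set (plane R),
  [/\ compact H.1 /\ connected H.1, compact H.2 /\ connected H.2,
      edge ij.1 ij.2 = H.1 `|` H.2, H.1 `&` H.2 !=set0 &
      [/\ H.1 (pt (b ij.2)), H.2 (pt (t ij.1 ij.2)),
      ~ H.1 (pt (t ij.1 ij.2)) & ~ H.2 (pt (b ij.2))]].
  by case=> i j; exact: arc_split (edge_arcP E (bt i j)).
pose A1 i j := (H0 (i, j)).1; pose A2 i j := (H0 (i, j)).2.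
have A1c i j : compact (A1 i j) /\ connected (A1 i j) by have [] := H0P (i, j).
have A2c i j : compact (A2 i j) /\ connected (A2 i j) by have [] := H0P (i, j).
have A12 i j : A1 i j `&` A2 i j !=set0 by have [] := H0P (i, j).
have A1b i j : A1 i j (pt (b j)) by have [_ _ _ _ []] := H0P (i, j).
have A2t i j : A2 i j (pt (t i j)) by have [_ _ _ _ []] := H0P (i, j).
have A1t i j : ~ A1 i j (pt (t i j)) by have [_ _ _ _ []] := H0P (i, j).
have A2b i j : ~ A2 i j (pt (b j)) by have [_ _ _ _ []] := H0P (i, j).
have A1e i j : A1 i j `<=` edge i j by have [_ _ -> _ _] := H0P (i, j); left.
have A2e i j : A2 i j `<=` edge i j by have [_ _ -> _ _] := H0P (i, j); right.
have eS i j : edge i j `<=` drawing E S by apply: drawing_edge => //; apply: VS.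
have DS i : drawing E (V i) `<=` drawing E S by apply: drawing_sub.
have A1V i j i' p : A1 i j p -> drawing E (V i') p -> False.
  by move=> Ap /(edge_drawing_V (A1e _ _ _ Ap))[_ pE]; apply: (@A1t i j); rewrite -pE.
(* The segment at [y i] has to avoid [Z i], which lies at distance at least [e i]. Staying within
   [e i / 2] of [y i] also keeps the segments for distinct indices apart. *)
pose Z i := (\bigcup_(ij in [set: I * bool]) A1 ij.1 ij.2) `|`
  (\bigcup_(ij in [set ij : I * bool | ij.1 != i]) (drawing E (V ij.1) `|` A2 ij.1 ij.2)).
have Zc i : compact (Z i).
  apply: compactU; first by apply: compact_bigcup_fin => ij _; case: (A1c ij.1 ij.2).
  apply: compact_bigcup_fin => ij _; apply: compactU; first exact: drawing_compact.
  by case: (A2c ij.1 ij.2).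
have yZ i : [set pt (y i)] `&` Z i = set0.
  apply/seteqP; split=> // _ [->].
  have Dy : drawing E (V i) (pt (y i)) by exact: drawing_vertex.
  case=> [[[i' j] _ /= Ap]|[[i' j] /= ii' [Dp|Ap]]].
  - exact: A1V Ap Dy.
  - exact: drawing_V_disj ii' Dp Dy.
  - have [i'E _] := edge_drawing_V (A2e _ _ _ Ap) Dy.
    by rewrite i'E eqxx in ii'.
have /choice[e eP] : forall i, exists e : R, 0 < e /\ forall z, Z i z -> e <= `|pt (y i) - z|.
  move=> i; have [e e0 eZ] := compact_separation (compact_set1 (x := pt (y i))) (@Zc i) (yZ i).
  by exists e; split => // z; apply: eZ.
have /choice[f fP] : forall i, exists f, F f /\ `|pt (y i) - f| < e i / 2.
  move=> i; have [e0 _] := eP i.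
  have [f Ff yf] := closure_near (@yF i) (divr_gt0 e0 (ltr0n _ 2)).
  by exists f.
have [i0 _] : exists i0 : I, true by have /card_gt0P[i0 _] : (0 < #|I|)%N := leq_trans (isT : 0 < 3)%N I3; exists i0.
have /choice[K0 K0P] : forall i, exists K, [/\ compact K, connected K, K `<=` F, K (f i0) & K (f i)].
  move=> i; apply: open_connected_continuum.
  - exact: outer_face_open.
  - exact: outer_face_connected.
  - by have [] := fP i0.
  - by have [] := fP i.
pose K := \bigcup_i K0 i.
have KF : K `<=` F by move=> p [i _]; have [_ _ + _ _] := K0P i; apply.
have Kc : compact K /\ connected K.
  split; first by apply: compact_bigcup_fin => i _; have [] := K0P i.
  apply: bigcup_connected; last by move=> i _; have [] := K0P i.
  by exists (f i0) => i _; have [] := K0P i.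
pose B (j : option bool) := if j is Some j then \bigcup_i A1 i j else K.
pose L i (j : option bool) := if j is Some j then A2 i j else segment (pt (y i)) (f i).
have segy i p : segment (pt (y i)) (f i) p -> `|pt (y i) - p| < e i / 2.
  have [e0 _] := eP i; have [_ yf] := fP i => /segment_ball; apply => //.
  by rewrite subrr normr0 divr_gt0.
have segZ i p : segment (pt (y i)) (f i) p -> Z i p -> False.
  move=> /segy yp /(proj2 (eP i)) ep; have [e0 _] := eP i; lra.
apply: (@K33_plane_links R I (option bool) B (fun i => drawing E (V i)) L) => //.
- by rewrite card_option card_bool.
- case=> [j|] //=; split; first by apply: compact_bigcup_fin => i _; case: (A1c i j).
  apply: bigcup_connected; last by move=> i _; case: (A1c i j).
  by exists (pt (b j)) => i _.
- by move=> i; split; [exact: drawing_compact|exact/drawing_connected/Vc].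
- move=> i [j|] /=; first exact: A2c.
  by have [] := segment_continuum (pt (y i)) (f i).
- have BB j j' p : j != j' -> (\bigcup_i A1 i j) p -> (\bigcup_i A1 i j') p -> False.
    move=> jj' [i _ Ap] [i' _ Ap'].
    have nij : (i, j) != (i', j') by apply: contra jj' => /eqP[_ ->].
    have [[_ pE]|[jE _]] := edge_edge (A1e _ _ _ Ap) (A1e _ _ _ Ap') nij.
      by apply: (@A1t i j); rewrite -pE.
    by rewrite jE eqxx in jj'.
  have BK j p : (\bigcup_i A1 i j) p -> K p -> False.
    by move=> [i _ /A1e/eS Dp] /KF Fp; exact: F_drawing Fp Dp.
  move=> [j|] [j'|] jj' //=; apply/seteqP; split => // p [].
  + by apply: BB; apply: contra jj' => /eqP->.
  + exact: BK.
  + by move=> /[swap]; exact: BK.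
- move=> i [j|] /=; apply/seteqP; split => // p [Dp].
    by move=> [i' _ Ap]; exact: A1V Ap Dp.
  by move=> /KF Fp; exact: F_drawing Fp (DS _ _ Dp).
- move=> i [j|] [j'|] jj' //=; apply/seteqP; split => // p [].
  + move=> Ap [i' _ Ap'].
    have nij : (i, j) != (i', j') by apply: contra jj' => /eqP[_ ->].
    have [[iE pE]|[jE _]] := edge_edge (A2e _ _ _ Ap) (A1e _ _ _ Ap') nij.
      apply: (A1V _ _ i _ Ap'); rewrite pE; apply: drawing_vertex; exact: tV.
    by rewrite jE eqxx in jj'.
  + by move=> /A2e/eS Dp /KF Fp; exact: F_drawing Fp Dp.
  + by move=> sp [i' _ Ap]; apply: segZ sp _; left; exists (i', j').
- move=> i i' ii'; apply/seteqP; split => // p [Dp Dp']; exact: drawing_V_disj ii' Dp Dp'.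
- move=> i i' [j|] ii' /=; apply/seteqP; split => // p [Dp].
    by move=> /A2e ep; have [iE _] := edge_drawing_V ep Dp; rewrite iE eqxx in ii'.
  by move=> sp; apply: segZ sp _; right; exists (i, true) => //; left.
- have AS i i' j p : i != i' -> A2 i j p -> segment (pt (y i')) (f i') p -> False.
    by move=> ii' Ap sp; apply: segZ sp _; right; exists (i, j) => //; right.
  have yy i i' : i != i' -> e i <= `|pt (y i) - pt (y i')|.
    move=> ii'; apply: (proj2 (eP i)); right; exists (i', true) => /=.
      by rewrite eq_sym.
    by left; exact: drawing_vertex.
  move=> i i' [j|] [j'|] ii' /=; apply/seteqP; split => // p [].
  + move=> Ap Ap'; have nij : (i, j) != (i', j') by apply: contra ii' => /eqP[->].
    have [[iE _]|[_ pE]] := edge_edge (A2e _ _ _ Ap) (A2e _ _ _ Ap') nij.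
      by rewrite iE eqxx in ii'.
    by apply: (@A2b i j); rewrite -pE.
  + exact: AS.
  + by move=> /[swap]; apply: AS; rewrite eq_sym.
  + move=> /segy yp /segy yp'.
    have := ler_distD p (pt (y i)) (pt (y i')); rewrite (distrC p).
    have := yy _ _ ii'; have : e i' <= `|pt (y i) - pt (y i')|.
      by rewrite distrC; apply: yy; rewrite eq_sym.
    lra.
- move=> i [j|] /=.
    by exists (pt (t i j)); split => //; apply: drawing_vertex.
  have [_ _ sy _] := segment_continuum (pt (y i)) (f i).
  by exists (pt (y i)); split => //; apply: drawing_vertex.
- move=> i [j|] /=.
    by have [p [p1 p2]] := A12 i j; exists p; split => //; exists i.
  have [_ _ _ sf] := segment_continuum (pt (y i)) (f i).
  by exists (f i); split => //; exists i => //; have [] := K0P i.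
Qed.

End EmbeddingK33.

(** * Layers of the ring graph *)

Section RingGraph.
Variables p k : nat.

(* A direction is a pair (vertical, negative); within a ring, the horizontal
   vertices are adjacent to the vertical ones, which makes the ring a 4-cycle. *)
Definition ring_vertex : finType := option ('I_p * 'I_k.+1 * (bool * bool)).

(** Rings are numbered from the inside: ring [k] is the outermost of [k.+1] rings. The additional
    vertex [a] is [None]. *)
Definition ring_adj (u v : ring_vertex) : bool :=
  match u, v with
  | None, None => false
  | None, Some (_, r, d) | Some (_, r, d), None => (r == k :> nat) && ~~ d.1
  | Some (i, r, d), Some (i', r', d') => (i == i') &&
      ((r == r') && (d.1 != d'.1) ||
       (d == d') && ((r.+1 == r' :> nat) || (r'.+1 == r :> nat)))
  end.

Lemma ring_adj_sym : symmetric ring_adj.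
Proof.
move=> [[[i r] d]|] [[[i' r'] d']|] //=.
by rewrite eq_sym (eq_sym r) (eq_sym d) (eq_sym d.1) orbC (orbC (_.+1 == _)) orbC.
Qed.

Lemma ring_adj_irrefl : irreflexive ring_adj.
Proof. by move=> [[[i r] [a b]]|] //=; rewrite !eqxx /=; lia. Qed.

Definition ring_graph : sgraph := SGraph ring_adj_sym ring_adj_irrefl.

Implicit Types (i : 'I_p) (j : nat).

Definition disk i j : set ring_graph :=
  [set v | exists (r : 'I_k.+1) (d : bool * bool), v = Some (i, r, d) /\ (r <= j)%N].

Definition open_disk i j : set ring_graph :=
  [set v | exists (r : 'I_k.+1) (d : bool * bool), v = Some (i, r, d) /\ (r < j)%N].

Lemma linked_radial (X : set ring_graph) i (r r' : 'I_k.+1) d : (r <= r')%N ->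
  (forall r0 : 'I_k.+1, (r <= r0 <= r')%N -> X (Some (i, r0, d))) ->
  linked ring_adj X (Some (i, r, d)) (Some (i, r', d)).
Proof.
case: r' => r' r'k /=; elim: r' r'k => [|m IH] mk rm HX.
  have -> : r = Ordinal mk by apply: val_inj => /=; lia.
  by apply: linked_refl; apply: HX; rewrite leqnn andbT; lia.
have [rE|rm'] := eqVneq (nat_of_ord r) m.+1.
  have -> : r = Ordinal mk by apply: val_inj.
  by apply: linked_refl; apply: HX; rewrite /= leqnn; lia.
have mk' : (m < k.+1)%N by lia.
apply: (@linked_trans _ _ _ _ (Some (i, Ordinal mk', d))).
  by apply: IH => [|r0 r0m]; [lia|apply: HX; lia].
apply: linked_step.
- by apply: HX => /=; lia.
- by apply: HX => /=; lia.
- by rewrite /= !eqxx /= orbT.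
Qed.

Lemma linked_ring (X : set ring_graph) i r d d' :
  (forall d, X (Some (i, r, d))) -> linked ring_adj X (Some (i, r, d)) (Some (i, r, d')).
Proof.
move=> HX; have [dd|dd] := eqVneq d.1 d'.1; last first.
  by apply: linked_step => //=; rewrite !eqxx dd.
apply: (@linked_trans _ _ _ _ (Some (i, r, (~~ d.1, false)))); apply: linked_step => //=;
  by rewrite !eqxx /= -?dd; case: (d.1).
Qed.

Lemma open_disk_connected i j : walk_connected ring_adj (open_disk i j).
Proof.
move=> _ _ [r [d [-> rj]]] [r' [d' [-> rj']]].
have X0 (r0 : 'I_k.+1) d0 : (r0 < j)%N -> open_disk i j (Some (i, r0, d0)) by exists r0, d0.
apply: (@linked_trans _ _ _ _ (Some (i, r', d))); last by apply: linked_ring => d0; exact: X0.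
case/orP: (leq_total r r') => rr; last apply: (linked_sym ring_adj_sym);
  by apply: linked_radial => // r0 r0r; apply: X0; lia.
Qed.

Lemma outside_disk_linked i j v : ~ disk i j v -> linked ring_adj (~` disk i j) v None.
Proof.
have XN : (~` disk i j) None by move=> [r [d []]].
case: v => [[[i' r] d]|] nv; last exact: linked_refl.
have X0 (r0 : 'I_k.+1) d0 : (r <= r0)%N -> (~` disk i j) (Some (i', r0, d0)).
  by move=> rr [r1 [d1 [[ii <- _] r1j]]]; apply: nv; exists r, d; rewrite ii; split => //; lia.
apply: (@linked_trans _ _ _ _ (Some (i', ord_max, d))).
  apply: linked_radial => [|r0 /andP[rr _]]; first by rewrite -ltnS.
  exact: X0.
have rk : (r <= k)%N by rewrite -ltnS.
apply: (@linked_trans _ _ _ _ (Some (i', ord_max, (false, false)))).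
  by apply: linked_ring => d0; apply: X0.
by apply: linked_step => //; [apply: X0|rewrite /= eqxx].
Qed.

Lemma outside_disk_connected i j : walk_connected ring_adj (~` disk i j).
Proof.
apply: (walk_connected_center ring_adj_sym (p := None)) => v.
by move=> /outside_disk_linked; exact: linked_sym ring_adj_sym _ _ _.
Qed.

Lemma ring_outer_neighbor i (j : 'I_k.+1) s : exists2 o : ring_graph,
  ~ disk i j o & ring_adj o (Some (i, j, (false, s))).
Proof.
have [jk|jk] := eqVneq (nat_of_ord j) k.
  by exists None; [move=> [r [d []]]|rewrite /= jk eqxx].
have jk' : (j.+1 < k.+1)%N by case: j jk => /=; lia.
exists (Some (i, Ordinal jk', (false, s))).
  by move=> [r [d [[<- _] /=]]]; lia.
by rewrite /= !eqxx /= !orbT.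
Qed.

Section Layers.
Variables (R : realType) (E : plane_embedding R ring_graph).

(** Relative to the drawing of the disk, [x] lies in the outer face, and so does every vertex off
    the disk, because these are connected; hence the horizontal vertices of ring [j] lie on the
    boundary of that face. If an inner vertex [y] did too, [embedding_no_K33] would apply, with the
    vertical vertices as its [b]. *)
Lemma disk_outer_vertices i (j : 'I_k.+1) x : outer_vertices E setT x ->
  (forall r d, x <> Some (i, r, d)) ->
  outer_vertices E (disk i j) `&` open_disk i j = set0.
Proof.
move=> [_ xF] xi; apply/seteqP; split => // y [[yD yF] yI].
have nx : ~ disk i j x by move=> [r [d [xE _]]]; exact: (xi r d).
have Fx : outer_face E (disk i j) (vertex_pt E x).
  apply: outer_face_vertex; last exact: vertex_notin_drawing.
  by apply: closure_subset xF; exact: outer_face_antimono.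
have FO o : ~ disk i j o -> outer_face E (disk i j) (vertex_pt E o).
  by move=> no; apply: outer_face_linked Fx; exact: outside_disk_connected.
have FE s : closure (outer_face E (disk i j)) (vertex_pt E (Some (i, j, (false, s)))).
  have [o no oj] := ring_outer_neighbor i j s.
  by have [] := outer_face_edge (oj : @adj ring_graph _ _) no (FO _ no).
have [r0 [d0 [yE r0j]]] := yI.
(* Ring [j.-1] provides the inner neighbors of the vertical vertices; [j] is positive because [y]
   lies strictly inside. *)
have jj : (j.-1 < k.+1)%N by case: j {xF xi nx Fx FO FE yD yF yI r0j} => /=; lia.
pose V (a : option bool) : set ring_graph :=
  if a is Some s then [set Some (i, j, (false, s))] else open_disk i j.
pose t (a : option bool) s : ring_graph :=
  if a is Some s' then Some (i, j, (false, s')) else Some (i, Ordinal jj, (true, s)).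
pose z (a : option bool) : ring_graph := if a is Some s then Some (i, j, (false, s)) else y.
apply: (@embedding_no_K33 R ring_graph E (disk i j) (option bool) V
  (fun s => Some (i, j, (true, s))) t z) => //.
- by rewrite card_option card_bool.
- move=> [s|] v /=; first by move=> ->; exists j, (false, s).
  by move=> [r [d [-> rj]]]; exists r, d; split => //; exact: ltnW.
- by move=> s; exists j, (true, s).
- by move=> [s|] s' //= [r [d [[<- _]]]]; rewrite ltnn.
- move=> [s|] [s'|] ss //=; apply/seteqP; split => // v [].
  + by move=> -> [] sE; rewrite sE eqxx in ss.
  + by move=> -> [r [d [[<- _]]]]; rewrite ltnn.
  + by move=> [r [d [-> rj]]] [rE _]; rewrite rE ltnn in rj.
- move=> [s|]; last exact: open_disk_connected.
  by move=> u v -> ->; exact: linked_refl.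
- by move=> [s|] s' //=; exists (Ordinal jj), (true, s'); split => //=; lia.
- move=> [s|] s' /=; rewrite !eqxx //=.
  by rewrite prednK ?eqxx ?orbT //; lia.
- by move=> [s|].
- by move=> [s|] /=; [exact: FE|exact: yF].
Qed.

(** If a round removed nothing, the next one would face the same set, and so on up to the last
    round, which removes all of a nonempty set. *)
Lemma outer_vertices_nonempty (S : set ring_graph) m :
  outerplane_on E m S -> outer_vertices E S !=set0.
Proof.
elim: m S => [//|[|m] IH] S /=; first by move=> [[v Sv] SO]; exists v; exact: SO.
have [O0|/set0P//] := eqVneq (outer_vertices E S) set0.
by rewrite O0 setD0 => /IH; rewrite O0.
Qed.

(** A round removes from the disk bounded by ring [j] only vertices of that ring, so the next
    smaller disk survives. By monotonicity this holds whatever else [S] contains. *)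
Lemma outerplane_on_disk i x m (j : 'I_k.+1) (S : set ring_graph) :
  outer_vertices E setT x -> (forall r d, x <> Some (i, r, d)) ->
  outerplane_on E m S -> disk i j `<=` S -> (j < m)%N.
Proof.
move=> xO xi; elim: m j S => [//|m IH] j S.
have step v : disk i j `<=` S -> open_disk i j v -> ~ outer_vertices E S v.
  move=> DS Iv Ov; suff : set0 v by [].
  rewrite -(disk_outer_vertices j xO xi); split => //.
  apply: outer_vertices_antimono DS _ _; split => //.
  by have [r [d [-> rj]]] := Iv; exists r, d; split => //; exact: ltnW.
case: m IH => [|m] IH H DS.
  (* In the last round every vertex is outer, so nothing lies strictly inside ring [j]. *)
  case: H => _ SO; rewrite ltnS leqNgt; apply/negP => j0.
  have Iv : open_disk i j (Some (i, ord0, (true, true))) by exists ord0, (true, true).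
  apply: (step _ DS Iv); apply: SO; apply: DS.
  by exists ord0, (true, true).
have [->//|j0] := posnP j.
have jj : (j.-1 < k.+1)%N by apply: leq_ltn_trans (leq_pred _) (ltn_ord j).
suff : (Ordinal jj < m.+1)%N by rewrite /= => H1; rewrite -ltnS -(prednK j0) /= ltnS.
apply: IH H _ => v [r [d [-> /= rj]]].
have rj' : (r < j)%N by rewrite -(prednK j0) ltnS.
split; first by apply: DS; exists r, d; split => //; exact: ltnW.
by apply: step DS _; exists r, d.
Qed.

Lemma ring_graph_layers m : (1 < p)%N -> outerplane E m -> (k < m)%N.
Proof.
move=> p1 H; have [x xO] := outer_vertices_nonempty H.
have [i xi] : exists i : 'I_p, forall r d, x <> Some (i, r, d).
  have p0 := ltnW p1.
  case: x xO => [[[i' r'] d'] _|_]; last by exists (Ordinal p0).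
  have [i0|i0] := eqVneq i' (Ordinal p0).
    by exists (Ordinal p1) => r d [ii _ _]; move: i0; rewrite ii => /(congr1 val).
  by exists (Ordinal p0) => r d [ii _ _]; rewrite ii eqxx in i0.
exact: (@outerplane_on_disk i x m ord_max setT).
Qed.

End Layers.
End RingGraph.

(** * Pixel representations of the ring graph *)

Lemma linked_column (X : set pixel) x (a b : int) :
  (forall c, (a <= c <= b) || (b <= c <= a) -> X (x, c)) ->
  linked pixel_adj X (x, a) (x, b).
Proof.
wlog ab : a b / a <= b.
  move=> H HX; case/orP: (le_total a b) => ab; first exact: H.
  by apply: (linked_sym pixel_adj_sym); apply: H => // c; rewrite orbC; exact: HX.
have -> : b = a + `|b - a|%N%:Z by lia.
elim: `|b - a|%N => [|n IH] HX.
  by rewrite addr0; apply: linked_refl; apply: HX; lia.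
apply: (linked_trans (IH _)); first by move=> c H; apply: HX; lia.
apply: linked_step; first by apply: HX; lia.
  by apply: HX; lia.
by rewrite /pixel_adj /= eqxx; lia.
Qed.

Lemma linked_row (X : set pixel) y (a b : int) :
  (forall c, (a <= c <= b) || (b <= c <= a) -> X (c, y)) ->
  linked pixel_adj X (a, y) (b, y).
Proof.
wlog ab : a b / a <= b.
  move=> H HX; case/orP: (le_total a b) => ab; first exact: H.
  by apply: (linked_sym pixel_adj_sym); apply: H => // c; rewrite orbC; exact: HX.
have -> : b = a + `|b - a|%N%:Z by lia.
elim: `|b - a|%N => [|n IH] HX.
  by rewrite addr0; apply: linked_refl; apply: HX; lia.
apply: (linked_trans (IH _)); first by move=> c H; apply: HX; lia.
apply: linked_step; first by apply: HX; lia.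
  by apply: HX; lia.
by rewrite /pixel_adj /= eqxx; lia.
Qed.

Lemma argmax_pixel (s : seq pixel) (P : set pixel) (f : pixel -> int) :
  (forall q, P q -> q \in s) -> P !=set0 ->
  exists2 q, P q & forall q', P q' -> f q' <= f q.
Proof.
elim: s P => [|a s IH] P Ps [q Pq]; first by have := Ps _ Pq.
have [Pa|nPa] := pselect (P a); last first.
  apply: IH; last by exists q.
  move=> r Pr; have := Ps _ Pr; rewrite inE => /orP[/eqP ra|//].
  by rewrite ra in Pr.
have [[r [Pr ra]]|nr] := pselect (exists r, P r /\ r != a); last first.
  exists a => // r Pr; have [->//|ra] := eqVneq r a.
  by case: nr; exists r.
have [] := IH [set r | P r /\ r != a].
- by move=> z [Pz za]; have := Ps _ Pz; rewrite inE (negPf za).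
- by exists r.
move=> m [Pm ma] mmax; have [fam|fam] := leP (f a) (f m).
  by exists m => // z Pz; have [->//|za] := eqVneq z a; exact: mmax.
exists a => // z Pz; have [->//|za] := eqVneq z a.
exact: le_trans (mmax z (conj Pz za)) (ltW fam).
Qed.

Section Representation.
Variables (G : sgraph) (B : G -> {fset pixel}).
Hypothesis HB : pixel_representation B.

Definition region (P : set G) : set pixel := [set q | exists2 v, P v & q \in B v].

Lemma blob_connected v : walk_connected pixel_adj [set q | q \in B v].
Proof.
move=> q r qv rv; have [_ /(_ q r qv rv)[s [qs sr sB]]] := pixel_rep_blob HB v.
by exists s; split => // x; rewrite inE => /orP[/eqP->//|/sB].
Qed.

Lemma blob_nonempty v : exists q, q \in B v.
Proof. by have [/fset0Pn] := pixel_rep_blob HB v. Qed.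

Lemma blob_touch (u v : G) : adj u v ->
  touch pixel_adj [set q | q \in B u] [set q | q \in B v].
Proof.
move=> uv; apply: (proj2 (pixel_rep_adj HB _)) => //.
by apply/eqP; exact: adj_neq.
Qed.

Lemma blob_disjoint u v q : q \in B u -> q \in B v -> u = v.
Proof.
move=> qu qv; apply/eqP/negPn/negP => /(pixel_rep_disjoint HB)/fdisjointP/(_ q qu).
by rewrite qv.
Qed.

Lemma region_connected (P : set G) : walk_connected (@adj G) P ->
  walk_connected pixel_adj (region P).
Proof.
move=> Pc q r [u Pu qu] [v Pv rv].
have sub w : P w -> [set q | q \in B w] `<=` region P by move=> Pw x xw; exists w.
have [s [us lsv Ps]] := Pc _ _ Pu Pv.
elim: s u q us Ps lsv Pu qu => [|w s IH] u q /=.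
  by move=> _ _ -> _ qu; apply: linked_sub (sub _ Pv) (blob_connected qu rv).
move=> /andP[uw ws] Ps lsv Pu qu.
have [a [b [au bw ab]]] := blob_touch uw.
have Pw : P w by apply: Ps; rewrite !inE eqxx orbT.
apply: linked_trans (linked_sub (sub _ Pu) (blob_connected qu au)) _.
apply: (@linked_trans _ _ _ _ b).
  by apply: linked_step => //; [exists u|exists w].
by apply: IH ws _ lsv Pw bw => x xs; apply: Ps; rewrite inE xs orbT.
Qed.

Lemma region_disjoint (P Q : set G) : P `&` Q = set0 -> region P `&` region Q = set0.
Proof.
move=> PQ; apply/seteqP; split => // q [[u Pu qu] [v Qv qv]].
suff : set0 u by []. 
by rewrite -PQ; split => //; rewrite (blob_disjoint qu qv).
Qed.

Lemma region_sub (P Q : set G) : P `<=` Q -> region P `<=` region Q.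
Proof. by move=> PQ q [v Pv qv]; exists v => //; exact: PQ. Qed.

Lemma region_fin : exists s : seq pixel, forall q, region setT q -> q \in s.
Proof.
exists (flatten [seq enum_fset (B v) | v <- enum G]) => q [v _ qv].
by apply/flattenP; exists (enum_fset (B v)) => //; apply: map_f; rewrite mem_enum.
Qed.

End Representation.

Section RingPixels.
Variables (p k : nat) (B : ring_graph p k -> {fset pixel}).
Hypothesis HB : pixel_representation B.
Implicit Types (i : 'I_p) (j : nat).

(** The set [X] is the outside of the disk, enlarged by pixels of no blob in the disk. With the
    vertical vertices it forms one side of a K33, against the horizontal vertices and the open
    disk. *)
Lemma no_inner_access i (j : 'I_k.+1) (X : set pixel) :
  walk_connected pixel_adj X -> region B (~` disk i j) `<=` X ->
  X `&` region B (disk i j) = set0 -> ~ touch pixel_adj (region B (open_disk i j)) X.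
Proof.
move=> Xc OX XD XI.
have [r0 [d0 rj]] : exists (r : 'I_k.+1) (d : bool * bool), (r < j)%N.
  by have [_ [_ [[v [r [d [_ rj]]] _] _ _]]] := XI; exists r, d.
have jj : (j.-1 < k.+1)%N by case: (j) rj => /=; lia.
have disk_j d : disk i j (Some (i, j, d)) by exists j, d.
have open_sub : (open_disk i j : set (ring_graph p k)) `<=` disk i j.
  by move=> v [r [d [-> rj']]]; exists r, d; split => //; exact: ltnW.
pose V (a : option bool) : set (ring_graph p k) :=
  if a is Some s then [set Some (i, j, (false, s))] else open_disk i j.
pose W (a : option bool) : set pixel :=
  if a is Some s then region B [set Some (i, j, (true, s))] else X.
have set1_conn (v : ring_graph p k) : walk_connected (@adj (ring_graph p k)) [set v].
  by move=> a b -> ->; exact: linked_refl.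
have VD a : V a `<=` disk i j by case: a => [s|] //= v ->.
apply: (@K33_pixel (option bool) (option bool) (fun a => region B (V a)) W).
- by rewrite card_option card_bool.
- by rewrite card_option card_bool.
- move=> a; apply: region_connected => //; case: a => [s|]; first exact: set1_conn.
  exact: open_disk_connected.
- by move=> [s|] //=; apply: region_connected.
- move=> [s|] [s'|] ss //=; apply: region_disjoint => //; apply/seteqP; split => // v [].
  + by move=> -> [] sE; rewrite sE eqxx in ss.
  + by move=> -> [r [d [[<- _]]]]; rewrite ltnn.
  + by move=> [r [d [-> rj']]] [rE _]; rewrite rE ltnn in rj'.
- have RX s : region B [set Some (i, j, (true, s))] `<=` region B (disk i j).
    by apply: region_sub => v ->.
  move=> [s|] [s'|] ss //=; apply/seteqP; split => // q [].
  + move=> [u -> qu] [v -> qv]; have [] := blob_disjoint HB qu qv => sE.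
    by rewrite sE eqxx in ss.
  + by move=> /RX Dq Xq; rewrite -XD.
  + by move=> Xq /RX Dq; rewrite -XD.
- move=> a [s|] /=.
    apply: region_disjoint => //; apply/seteqP; split => // v [+ vE]; rewrite {}vE.
    by case: a => [s'|] //= [r [d [[<- _]]]]; rewrite ltnn.
  by apply/seteqP; split => // q [/(region_sub (@VD a)) Dq Xq]; rewrite -XD.
- have T (P Q : set (ring_graph p k)) (u v : ring_graph p k) : P u -> Q v -> adj u v ->
      touch pixel_adj (region B P) (region B Q).
    move=> Pu Qv /(blob_touch HB)[a [b [au bv ab]]].
    by exists a, b; split => //; [exists u|exists v].
  move=> [s|] [s'|] //=.
  + by apply: (T _ _ (Some (i, j, (false, s))) (Some (i, j, (true, s')))); rewrite //= !eqxx.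
  + have [o no oj] := ring_outer_neighbor i j s.
    have [a [b [ao bj ab]]] := T (~` disk i j) [set Some (i, j, (false, s))] _ _ no erefl oj.
    by exists b, a; split; rewrite 1?pixel_adj_sym //; exact: OX.
  + apply: (T _ _ (Some (i, Ordinal jj, (true, s'))) (Some (i, j, (true, s')))) => //.
      by exists (Ordinal jj), (true, s'); split => //=; lia.
    by rewrite /= !eqxx /= prednK ?eqxx ?orbT //; lia.
Qed.

Section Copy.
Variables (z : pixel) (x : ring_graph p k) (i : 'I_p) (m : int).
Hypotheses (zx : z \in B x) (zmax : forall q, region B setT q -> q.2 <= z.2).
Hypothesis mmin : forall q, region B setT q -> m < q.1.
Hypothesis xi : forall r d, x <> Some (i, r, d).

(* The ray [D] starting next to [q] completes the outside of the disk to a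
   connected set that touches the blob of [q]. *)
Lemma no_escape (j : 'I_k.+1) q (D : set pixel) :
  region B (open_disk i j) q ->
  D `&` region B (disk i j) = set0 ->
  (exists2 q', D q' & pixel_adj q q') ->
  (forall q', D q' -> linked pixel_adj (D `|` [set c | (c.1 <= m) || (z.2 < c.2)]) q' (m, z.2 + 1)) ->
  False.
Proof.
move=> qI DD [q0 Dq0 qq0] Dl.
(* The frame [Fr], left of and above all blobs, is in one piece. The topmost pixel [z] ties it to
   the outside of the disk, because its vertex [x] is not in copy [i]. *)
pose Fr : set pixel := [set c | (c.1 <= m) || (z.2 < c.2)].
pose O := region B (~` disk i j).
have FB c : Fr c -> ~ region B setT c.
  by move=> /orP[cm|cz] Rc; [have := mmin Rc|have := zmax Rc]; rewrite (ltNge, leNgt) ?cm ?cz.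
have Frl c : Fr c -> linked pixel_adj (O `|` (D `|` Fr)) c (m, z.2 + 1).
  move=> Fc; apply: (@linked_sub _ _ Fr) => [r|]; first by right; right.
  case: c Fc => a b /orP[/= am|/= bz].
    apply: (@linked_trans _ _ _ _ (a, z.2 + 1)).
      by apply: linked_column => c _; rewrite /Fr /= am.
    by apply: linked_row => c _; rewrite /Fr /= ltrDl orbT.
  apply: (@linked_trans _ _ _ _ (m, b)).
    by apply: linked_row => c _; rewrite /Fr /= bz orbT.
  by apply: linked_column => c _; rewrite /Fr /= lexx.
have zO : O z by exists x => // -[r [d [xE _]]]; exact: (xi xE).
apply: (@no_inner_access i j (O `|` (D `|` Fr))).
- apply: (walk_connected_center pixel_adj_sym (p := (m, z.2 + 1))) => c.
  case=> [Oc|[Dc|Fc]]; apply: (linked_sym pixel_adj_sym); last exact: Frl.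
    apply: (@linked_trans _ _ _ _ z).
      apply: (@linked_sub _ _ O) => [r|]; first by left.
      exact: (region_connected HB (@outside_disk_connected p k i j)).
    apply: (@linked_trans _ _ _ _ (z.1, z.2 + 1)).
      apply: linked_step; [by left|by right; right; rewrite /Fr /= ltrDl orbT|].
      by case: (z) => a b; rewrite /pixel_adj /= eqxx; lia.
    by apply: Frl; rewrite /Fr /= ltrDl orbT.
  by apply: linked_sub (Dl _ Dc) => r; right.
- by move=> c; left.
- rewrite setIUl setIUl DD set0U; apply/seteqP; split => // c [[Oc Dc]|[Fc Dc]].
    rewrite -(region_disjoint HB (P := ~` disk i j) (Q := disk i j)) //.
    by apply/seteqP; split=> // v [].
  by apply: (FB _ Fc); apply: region_sub Dc.
- by exists q, q0; split => //; right; left.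
Qed.

Lemma higher_pixel (j : 'I_k.+1) q : region B (open_disk i j) q ->
  exists2 q', region B (disk i j) q' & q'.1 = q.1 /\ q.2 < q'.2.
Proof.
move=> qI; apply: contrapT => nq.
apply: (@no_escape j q [set c | c.1 = q.1 /\ q.2 < c.2]) => //.
- by apply/seteqP; split=> // c [cq cD]; apply: nq; exists c.
- exists (q.1, q.2 + 1); first by split => //=; rewrite ltrDl.
  by case: (q) => a b; rewrite /pixel_adj /= eqxx; lia.
- case=> a b [/= -> qb]; apply: (@linked_trans _ _ _ _ (q.1, Num.max b (z.2 + 1))).
    by apply: linked_column => c cb; left; split => //=; lia.
  apply: (@linked_trans _ _ _ _ (m, Num.max b (z.2 + 1))).
    by apply: linked_row => c cb; right => /=; lia.
  by apply: linked_column => c cb; right => /=; lia.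
Qed.

Lemma lefter_pixel (j : 'I_k.+1) q : region B (open_disk i j) q ->
  exists2 q', region B (disk i j) q' & q'.2 = q.2 /\ q'.1 < q.1.
Proof.
move=> qI; apply: contrapT => nq.
apply: (@no_escape j q [set c | c.2 = q.2 /\ c.1 < q.1]) => //.
- by apply/seteqP; split=> // c [cq cD]; apply: nq; exists c.
- exists (q.1 - 1, q.2); first by split => //=; lia.
  by case: (q) => a b; rewrite /pixel_adj /= eqxx; lia.
- case=> a b [/= -> qb]; apply: (@linked_trans _ _ _ _ (Num.min a m, q.2)).
    by apply: linked_row => c cb; left; split => //=; lia.
  apply: (@linked_trans _ _ _ _ (Num.min a m, z.2 + 1)).
    by apply: linked_column => c cb; right => /=; lia.
  by apply: linked_row => c cb; right => /=; lia.
Qed.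

(** Each further disk gains a column on the left: the leftmost pixel of the smaller disk has a pixel
    of the larger one to its left. *)
Lemma disk_columns (j : nat) : (j <= k)%N -> exists s : seq int,
  [/\ uniq s, size s = j.+1 & {in s, forall a, exists2 q, region B (disk i j) q & q.1 = a}].
Proof.
elim: j => [|j IH] jk.
  have [q qB] := blob_nonempty HB (Some (i, ord0, (true, true))).
  exists [:: q.1]; split => // a; rewrite inE => /eqP ->; exists q => //.
  by exists (Some (i, ord0, (true, true))) => //; exists ord0, (true, true).
have [s [us ss Hs]] := IH (ltnW jk).
have [l Hl] := region_fin B.
have [||q0 q0D q0min] := @argmax_pixel l (region B (disk i j)) (fun q => - q.1).
- by move=> q Dq; apply: Hl; apply: region_sub Dq.
- case: s ss Hs {us} => // a s _ /(_ a (mem_head _ _))[q Dq _]; by exists q.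
have jk' : (j.+1 < k.+1)%N by [].
have [|q Dq [_ qq0]] := @lefter_pixel (Ordinal jk') q0.
  by apply: region_sub q0D => v [r [d [-> rj]]]; exists r, d.
have new : q.1 \notin s.
  apply/negP => /Hs[q1 Dq1 q1E]; have := q0min _ Dq1; lia.
exists (q.1 :: s); split => /=; [by rewrite new|by rewrite ss|] => a.
rewrite inE => /orP[/eqP->|/Hs[q1 Dq1 <-]]; first by exists q.
exists q1 => //; apply: region_sub Dq1 => v [r [d [-> rj]]].
by exists r, d; split => //; exact: leqW.
Qed.

Lemma ring_size (j : 'I_k.+1) : (j < \sum_(d : bool * bool) #|` B (Some (i, j, d))|)%N.
Proof.
have [s [us ss Hs]] := disk_columns (leq_ord j : (j <= k)%N).
have [l Hl] := region_fin B.
rewrite -ss.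
(* The pixels of the ring are listed by their columns, so that it suffices to find every column of
   [s] in the list. *)
have -> : (\sum_(d : bool * bool) #|` B (Some (i, j, d))| =
    size (flatten [seq [seq q.1 | q <- enum_fset (B (Some (i, j, d)))] | d : bool * bool]))%N.
  rewrite size_flatten /shape -map_comp sumnE big_map big_enum /=.
  by apply: eq_bigr => d _; rewrite size_map.
apply: uniq_leq_size us _ => a /Hs[q Dq qa].
have [||q0 [q0D q0a] q0max] := @argmax_pixel l
    [set c | region B (disk i j) c /\ c.1 = a] (fun q => q.2).
- by move=> c [Dc _]; apply: Hl; apply: region_sub Dc.
- by exists q.
have [v [r [d [vE rj]]] q0v] := q0D; subst v.
have rjE : r = j.
  apply: contrapT => nrj.
  have rj' : (r < j)%N.
    by rewrite ltn_neqAle rj andbT; apply/eqP => /val_inj.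
  have [|q1 Dq1 [q1a q1q0]] := @higher_pixel j q0.
    by exists (Some (i, r, d)) => //; exists r, d.
  have := q0max q1 (conj Dq1 (etrans q1a q0a)).
  by rewrite leNgt q1q0.
subst r; apply/flattenP; exists [seq q.1 | q <- enum_fset (B (Some (i, j, d)))].
  by apply: map_f; rewrite mem_enum.
by apply/mapP; exists q0.
Qed.

End Copy.

Lemma ring_pixel_size : (1 < p)%N ->
  (p.-1 * (\sum_(j < k.+1) j.+1) <= pixel_size B)%N.
Proof.
move=> p1; have [l Hl] := region_fin B.
have RN : region B setT !=set0.
  by have [q qN] := blob_nonempty HB None; exists q; exists None.
have [z [x _ zx] zmax] := @argmax_pixel l _ (fun q => q.2) Hl RN.
have [q0 _ q0min] := @argmax_pixel l _ (fun q => - q.1) Hl RN.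
(* The copy of the topmost pixel is given up; if that pixel belongs to [None], any copy may be. *)
have [i0 Hi0] : exists i0 : 'I_p, forall i, i != i0 -> forall r d, x <> Some (i, r, d).
  case: (x) => [[[i0 r0] d0]|]; last by exists (Ordinal (ltnW p1)).
  by exists i0 => i ii0 r d [iE _ _]; rewrite iE eqxx in ii0.
have H i (j : 'I_k.+1) : i != i0 ->
    (j < \sum_(d : bool * bool) #|` B (Some (i, j, d))|)%N.
  move=> ii0; apply: (@ring_size z x i (q0.1 - 1)) => //; last exact: Hi0.
  by move=> q /q0min; lia.
have -> : pixel_size B = (#|` B None| +
    \sum_(i < p) \sum_(j < k.+1) \sum_(d : bool * bool) #|` B (Some (i, j, d))|)%N.
  rewrite /pixel_size (bigD1 None) //=; congr addn.
  rewrite (reindex_omap Some id) /=; last by case.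
  rewrite !pair_bigA /=; apply: eq_big => [v|[[i j] d] _]; by rewrite /= ?eqxx.
rewrite (bigD1 i0) //= addnA; apply: leq_trans (leq_addl _ _).
rewrite -[p in p.-1]card_ord -(cardC1 i0) -sum_nat_const.
apply: leq_sum => i ii0; apply: leq_sum => j _; exact: H.
Qed.

End RingPixels.

(** * A drawing of the ring graph *)

Section RingDrawing.
Variables (R : realType) (p k : nat).
Local Notation V := (ring_vertex p k).
Implicit Types (i : 'I_p) (r : 'I_k.+1) (d : bool * bool) (s : bool) (u v w : V) (q : plane R).

(** A copy consists of concentric diamonds, L1 circles of radius at most [K]; with centers [3 * K]
    apart, distinct copies are well separated. The depth [H] of [None] exceeds the bound
    [3 * K * p%:R] on the horizontal coordinates of the other vertices, which is what [fan_outside]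
    needs. *)
Let K : R := k.+1%:R.
Let H : R := 4 * K * p%:R.
Definition ring_center (i : nat) : R := 3 * K * i%:R.
Definition ring_radius (r : nat) : R := r.+1%:R.
Definition sgn s : R := if s then -1 else 1.
Definition dir_x d : R := if d.1 then 0 else sgn d.2.
Definition dir_y d : R := if d.1 then sgn d.2 else 0.

Definition ring_pt v : plane R :=
  if v is Some (i, r, d) then (ring_center i + ring_radius r * dir_x d, ring_radius r * dir_y d)
  else (0, - H).

(** Fixing a direction for each edge leaves three kinds and, up to symmetry, six pairs of kinds to
    compare. *)
Inductive oriented_edge : V -> V -> Prop :=
| RingEdge i r s s' : oriented_edge (Some (i, r, (false, s))) (Some (i, r, (true, s')))
| RadialEdge i r r' d : r' = r.+1 :> nat ->
    oriented_edge (Some (i, r, d)) (Some (i, r', d))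
| FanEdge i r s : r = k :> nat -> oriented_edge None (Some (i, r, (false, s))).

Lemma ring_adj_oriented u v : ring_adj u v -> oriented_edge u v \/ oriented_edge v u.
Proof.
case: u v => [[[i r] d]|] [[[i' r'] d']|] //=.
- case/andP => /eqP <- /orP[/andP[/eqP<-]|/andP[/eqP<- /orP[]/eqP rr]].
  + case: d d' => [[] s] [[] s'] //= _; [right|left]; exact: RingEdge.
  + by left; apply: RadialEdge.
  + by right; apply: RadialEdge.
- by case: d => [[] s] /andP[/eqP rk] //= _; right; exact: FanEdge.
- by case: d' => [[] s] /andP[/eqP rk] //= _; left; exact: FanEdge.
Qed.

Lemma ring_radius_ge1 r : 1 <= ring_radius r.
Proof. by rewrite /ring_radius ler1n. Qed.

Lemma ring_radius_leK r : ring_radius r <= K.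
Proof. by rewrite /ring_radius /K ler_nat ltn_ord. Qed.

Lemma ring_radius_inj r r' : ring_radius r = ring_radius r' -> r = r'.
Proof. by move=> /eqP; rewrite eqr_nat eqSS => /eqP/val_inj. Qed.

Lemma ring_radius_lt r r' : (r < r')%N -> ring_radius r + 1 <= ring_radius r'.
Proof. by move=> rr; rewrite /ring_radius natr1 ler_nat. Qed.

Lemma ring_radiusS r r' : r' = r.+1 :> nat -> ring_radius r' = ring_radius r + 1.
Proof. by move=> ->; rewrite /ring_radius natr1. Qed.

Lemma ring_radius_k r : r = k :> nat -> ring_radius r = K.
Proof. by move=> ->. Qed.

Lemma K_ge1 : 1 <= K.
Proof. by rewrite /K ler1n. Qed.

Lemma ring_center_bound i : 0 <= ring_center i <= 3 * K * p%:R - 3 * K.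
Proof.
have K1 := K_ge1; rewrite /ring_center mulr_ge0 //=; last by lra.
have : (i : nat)%:R + 1 <= p%:R :> R by rewrite natr1 ler_nat.
by nra.
Qed.

Lemma ring_center_lt i i' : (i < i')%N -> ring_center i + 3 * K <= ring_center i'.
Proof.
have K1 := K_ge1; move=> ii; rewrite /ring_center.
have : (i : nat)%:R + 1 <= (i' : nat)%:R :> R by rewrite natr1 ler_nat.
by nra.
Qed.

Lemma ring_center_close i i' : - (3 * K) < ring_center i - ring_center i' < 3 * K -> i = i'.
Proof.
case/andP=> h1 h2; apply: val_inj; apply/eqP; rewrite eqn_leq.
by apply/andP; split; rewrite leqNgt; apply/negP => /ring_center_lt; lra.
Qed.

(** This is a side of a diamond: [a] and [b] are the absolute coordinates relative to the center. *)
Lemma ring_segment i r s s' q :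
  segment (ring_pt (Some (i, r, (false, s)))) (ring_pt (Some (i, r, (true, s')))) q ->
  exists a b, [/\ 0 <= a, 0 <= b, a + b = ring_radius r &
    q.1 = ring_center i + a * sgn s /\ q.2 = b * sgn s'].
Proof.
move=> [t + <-]; rewrite /= in_itv /= => /andP[t0 t1].
have r1 := ring_radius_ge1 r.
exists ((1 - t) * ring_radius r), (t * ring_radius r); split.
- by rewrite mulr_ge0; lra.
- by rewrite mulr_ge0; lra.
- by ring.
- by rewrite /dir_x /dir_y -![_ *: _]/(_ * _) /=; split; ring.
Qed.

Lemma radial_segment i r r' d q : r' = r.+1 :> nat ->
  segment (ring_pt (Some (i, r, d))) (ring_pt (Some (i, r', d))) q ->
  exists2 a, ring_radius r <= a <= ring_radius r + 1 &
    q.1 = ring_center i + a * dir_x d /\ q.2 = a * dir_y d.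
Proof.
move=> rr [t + <-]; rewrite /= in_itv /= => /andP[t0 t1].
exists (ring_radius r + t); first by lra.
by rewrite (ring_radiusS rr) -![_ *: _]/(_ * _); split; ring.
Qed.

Lemma fan_segment i r s q : r = k :> nat ->
  segment (ring_pt None) (ring_pt (Some (i, r, (false, s)))) q ->
  exists2 t, 0 <= t <= 1 &
    q.1 = (1 - t) * (ring_center i + K * sgn s) /\ q.2 = - (t * H).
Proof.
move=> rk [t + <-]; rewrite /= in_itv /= => /andP[t0 t1].
exists (1 - t); first by lra.
by rewrite (ring_radius_k rk) /dir_x /dir_y -![_ *: _]/(_ * _) /=; split; ring.
Qed.

Lemma sgn_inj s s' : sgn s = sgn s' -> s = s'.
Proof. by case: s s' => [] [] //=; lra. Qed.

Definition meet_at q u v u' v' : Prop :=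
  (u = u' /\ v = v') \/
  exists w, [/\ q = ring_pt w, w = u \/ w = v & w = u' \/ w = v'].

Lemma meet_at_sym q u v u' v' : meet_at q u v u' v' -> meet_at q u' v' u v.
Proof. by case=> [[-> ->]|[w [? ? ?]]]; [left|right; exists w]. Qed.

Lemma plane_eq (q q' : plane R) : q.1 = q'.1 -> q.2 = q'.2 -> q = q'.
Proof. by case: q q' => [a b] [c d] /= -> ->. Qed.

Lemma ring_ring_meet i r s1 s2 i' r' (s1' s2' : bool) q :
  let u := Some (i, r, (false, s1)) in let v := Some (i, r, (true, s2)) in
  let u' := Some (i', r', (false, s1')) in let v' := Some (i', r', (true, s2')) in
  segment (ring_pt u) (ring_pt v) q -> segment (ring_pt u') (ring_pt v') q ->
  meet_at q u v u' v'.
Proof.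
move=> u v u' v' /ring_segment[a [b [a0 b0 ab [q1 q2]]]] /ring_segment[a' [b' [a'0 b'0 ab' [q1' q2']]]].
have K1 := K_ge1; have rK := ring_radius_leK r; have rK' := ring_radius_leK r'.
have r1 := ring_radius_ge1 r; have r1' := ring_radius_ge1 r'.
have ii : i = i'.
  by apply: ring_center_close; move: q1 q1'; case: s1 {u v} s1' {u' v'} => [] [] /=; rewrite /sgn; lra.
subst i'.
have [aa bb] : a = a' /\ b = b'.
  move: q1 q2; rewrite q1' q2'.
  by case: s1 s2 s1' s2' {u v u' v' q1' q2'} => [] [] [] [] /=; rewrite /sgn; lra.
have rr : r = r' by apply: ring_radius_inj; lra.
subst a' b' r'.
have [s1E|s1N] := eqVneq s1 s1'; have [s2E|s2N] := eqVneq s2 s2'.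
- by left; rewrite /u /v s1E s2E.
- have b00 : b = 0.
    by move: q2 q2' s2N => ->; case: s2 s2' {v v'} => [] [] //=; rewrite /sgn; lra.
  right; exists u; split; [|by left|by left; rewrite /u s1E].
  by apply: plane_eq; rewrite ?q1 ?q2 /= /dir_x /dir_y /= ?b00; [congr (_ + _ * _); lra|lra].
- have a00 : a = 0.
    by move: q1 q1' s1N => ->; case: s1 s1' {u u'} => [] [] //=; rewrite /sgn; lra.
  right; exists v; split; [|by right|by right; rewrite /v s2E].
  by apply: plane_eq; rewrite ?q1 ?q2 /= /dir_x /dir_y /= ?a00; [lra|congr (_ * _); lra].
- have b00 : b = 0.
    by move: q2 q2' s2N => ->; case: s2 s2' {v v'} => [] [] //=; rewrite /sgn; lra.
  have a00 : a = 0.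
    by move: q1 q1' s1N => ->; case: s1 s1' {u u'} => [] [] //=; rewrite /sgn; lra.
  lra.
Qed.

Lemma ring_radial_meet i r s1 s2 i' r0 r1 d q : r1 = r0.+1 :> nat ->
  let u := Some (i, r, (false, s1)) in let v := Some (i, r, (true, s2)) in
  let u' := Some (i', r0, d) in let v' := Some (i', r1, d) in
  segment (ring_pt u) (ring_pt v) q -> segment (ring_pt u') (ring_pt v') q ->
  meet_at q u v u' v'.
Proof.
move=> r01 u v u' v' /ring_segment[a [b [a0 b0 ab [q1 q2]]]].
move=> /(radial_segment r01)[c cb [q1' q2']].
have K1 := K_ge1; have rK := ring_radius_leK r; have rK0 := ring_radius_leK r0; have rK1 := ring_radius_leK r1.
have r1r := ring_radius_ge1 r; have r10 := ring_radius_ge1 r0.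
have rS := ring_radiusS r01.
have ii : i = i'.
  apply: ring_center_close; move: q1 q1'; case: s1 {u v} d {u' v' q2'} => [] [[] []] /=;
  by rewrite /dir_x /sgn /=; lra.
subst i'.
have cr : c = ring_radius r.
  move: q1 q2; rewrite q1' q2'.
  by case: s1 s2 d {u v u' v' q1' q2'} => [] [] [[] []] /=; rewrite /dir_x /dir_y /sgn /=; lra.
have rr : r = r0 \/ r = r1.
  have [rr|rr|/val_inj] := ltngtP r r0; [|have [rr'|rr'|/val_inj] := ltngtP r r1|]; auto.
  - by exfalso; have := ring_radius_lt rr; lra.
  - by rewrite r01 ltnS leqNgt rr in rr'.
  - by exfalso; have := ring_radius_lt rr'; lra.
clear r01; have dE : d = (false, s1) \/ d = (true, s2).
  move: q1 q2; rewrite q1' q2'.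
  by case: s1 s2 d {u v u' v' q1' q2'} => [] [] [[] []] /=; rewrite /dir_x /dir_y /sgn /=; auto; move=> *; exfalso; lra.
right; exists (Some (i, r, d)); split.
- by apply: plane_eq; rewrite ?q1' ?q2' cr.
- by case: dE => ->; [left|right].
- by case: rr => ->; [left|right].
Qed.

Lemma radial_radial_meet i (r0 r1 r0' r1' : 'I_k.+1) d i' d' q :
  r1 = r0.+1 :> nat -> r1' = r0'.+1 :> nat ->
  let u := Some (i, r0, d) in let v := Some (i, r1, d) in
  let u' := Some (i', r0', d') in let v' := Some (i', r1', d') in
  segment (ring_pt u) (ring_pt v) q -> segment (ring_pt u') (ring_pt v') q ->
  meet_at q u v u' v'.
Proof.
move=> r01 r01' u v u' v' /(radial_segment r01)[c cb [q1 q2]].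
move=> /(radial_segment r01')[c' cb' [q1' q2']].
have K1 := K_ge1; have rK1 := ring_radius_leK r1; have rK1' := ring_radius_leK r1'.
have r10 := ring_radius_ge1 r0; have r10' := ring_radius_ge1 r0'.
have rS := ring_radiusS r01; have rS' := ring_radiusS r01'.
have ii : i = i'.
  apply: ring_center_close; move: q1 q1'; case: d {u v q2} d' {u' v' q2'} => [[] []] [[] []] /=;
  by rewrite /dir_x /sgn /=; lra.
subst i'.
have [dd cc] : d = d' /\ c = c'.
  clear r01 r01'; move: q1 q2; rewrite q1' q2'.
  by case: d d' {u v u' v' q1' q2'} => [[] []] [[] []]; rewrite /dir_x /dir_y /sgn /=; (do ?[by move=> *; exfalso; lra]) => *; split => //; lra.
subst d' c'.
have [rr|rr|/val_inj rr] := ltngtP r0 r0'.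
- have := ring_radius_lt rr => rl.
  have r1E : r1 = r0' by apply: ring_radius_inj; lra.
  right; exists v; split; [|by right|by left; rewrite /v r1E].
  have cE : c = ring_radius r1 by lra.
  by apply: plane_eq; rewrite ?q1 ?q2 cE.
- have := ring_radius_lt rr => rl.
  have r1E : r1' = r0 by apply: ring_radius_inj; lra.
  right; exists u; split; [|by left|by right; rewrite /v' r1E].
  have cE : c = ring_radius r0 by lra.
  by apply: plane_eq; rewrite ?q1 ?q2 cE.
- subst r0'; have r1E : r1 = r1' by apply: val_inj; rewrite /= r01.
  by left; rewrite /u /v /u' /v' r1E.
Qed.

(* In the L1 norm, an edge at [None] reaches the disk of radius [K] around a
   center only at its end [t = 0]. *)
Lemma fan_outside i i' s t : 0 <= t <= 1 ->
  `|(1 - t) * (ring_center i + K * sgn s) - ring_center i'| + `|t * H| <= K ->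
  t = 0 /\ i = i'.
Proof.
move=> /andP[t0 t1]; have K1 := K_ge1.
set W := ring_center i + K * sgn s.
have Wb : `|W| <= 3 * K * p%:R.
  have /andP[c0 c1] := ring_center_bound i; rewrite ler_norml /W.
  by case: (s) => /=; rewrite /sgn; lra.
have Wc : K <= `|W - ring_center i'| /\ (`|W - ring_center i'| <= K -> i = i').
  rewrite /W; have [ii|ii|/val_inj ii] := ltngtP i i'.
  - have := ring_center_lt ii; rewrite ler_normr ler_norml => cc.
    by case: (s) => /=; rewrite /sgn; (split; [lra|move=> ?; exfalso; lra]).
  - have := ring_center_lt ii; rewrite ler_normr ler_norml => cc.
    by case: (s) => /=; rewrite /sgn; (split; [lra|move=> ?; exfalso; lra]).
  - subst i'; split => //; rewrite ler_normr.
    by case: (s) => /=; rewrite /sgn; lra.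
have p0 : 1 <= p%:R :> R by rewrite ler1n; apply: leq_ltn_trans (leq0n i) (ltn_ord i).
have H0 : 0 <= H by rewrite /H !mulr_ge0 //; lra.
have -> : (1 - t) * W - ring_center i' = (W - ring_center i') - t * W by ring.
have := lerB_dist (W - ring_center i') (t * W).
rewrite (normrM t H) (normrM t W) (ger0_norm t0) (ger0_norm H0) => h1 h2.
have h3 : t * `|W| <= t * (3 * K * p%:R) by rewrite ler_wpM2l.
(* The factor [K * p%:R] is what [H] exceeds the bound on the norm of [W] by. *)
have h4 : t * (K * p%:R) <= 0 by have [? _] := Wc; rewrite /H in h2; lra.
have t00 : t = 0.
  apply/eqP; rewrite eq_le t0 andbT; rewrite pmulr_lle0 // in h4.
  by rewrite mulr_gt0 //; lra.
split=> //; apply: (proj2 Wc); rewrite t00 mul0r in h1 h2 *; lra.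
Qed.

Lemma fan_ring_meet i r0 s i' r s1 s2 q : r0 = k :> nat ->
  let u := Some (i', r, (false, s1)) in let v := Some (i', r, (true, s2)) in
  let v' := Some (i, r0, (false, s)) in
  segment (ring_pt None) (ring_pt v') q -> segment (ring_pt u) (ring_pt v) q ->
  meet_at q None v' u v.
Proof.
move=> rk u v v' /(fan_segment rk)[t t01 [q1 q2]] /ring_segment[a [b [a0 b0 ab [q1' q2']]]].
have K1 := K_ge1; have rK := ring_radius_leK r.
have [] := @fan_outside i i' s t t01.
  rewrite -q1 -(normrN (t * H)) -q2 q1' q2' addrAC subrr add0r !normrM.
  have n1 s0 : `|sgn s0| = 1 by case: s0; rewrite /= ?normrN normr1.
  by rewrite !n1 !mulr1 !ger0_norm //; lra.
move=> t0 ii; subst i' t.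
have rr : r = r0.
  apply: ring_radius_inj; rewrite (ring_radius_k rk).
  move: q1 q2; rewrite q1' q2'.
  by case: s s1 s2 {u v v' q1' q2'} => [] [] [] /=; rewrite /sgn; lra.
subst r; right; exists v'; split; [|by right|].
  by apply: plane_eq; rewrite ?q1 ?q2 /= (ring_radius_k rk) /dir_x /dir_y /=; lra.
left; rewrite /u /v'; congr (Some (_, (_, _))); apply: sgn_inj.
move: q1 q2; rewrite q1' q2' (ring_radius_k rk) in ab *.
by case: s s1 s2 {u v v' q1' q2'} => [] [] [] /=; rewrite /sgn; lra.
Qed.

Lemma fan_radial_meet i r0 s i' r r' d q : r0 = k :> nat -> r' = r.+1 :> nat ->
  let u := Some (i', r, d) in let v := Some (i', r', d) in
  let v' := Some (i, r0, (false, s)) in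
  segment (ring_pt None) (ring_pt v') q -> segment (ring_pt u) (ring_pt v) q ->
  meet_at q None v' u v.
Proof.
move=> rk rr u v v' /(fan_segment rk)[t t01 [q1 q2]] /(radial_segment rr)[a ab [q1' q2']].
have K1 := K_ge1; have rK := ring_radius_leK r'; have rS := ring_radiusS rr; have r1 := ring_radius_ge1 r.
have [] := @fan_outside i i' s t t01.
  rewrite -q1 -(normrN (t * H)) -q2 q1' q2' addrAC subrr add0r !normrM.
  have -> : `|dir_x d| = if d.1 then 0 else 1.
    by case: d {u v q1' q2'} => [[] []]; rewrite /dir_x /= ?normrN ?normr1 ?normr0.
  have -> : `|dir_y d| = if d.1 then 1 else 0.
    by case: d {u v q1' q2'} => [[] []]; rewrite /dir_y /= ?normrN ?normr1 ?normr0.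
  by rewrite ger0_norm; case: d.1; lra.
move=> t0 ii; subst i' t.
have [dE aK] : d = (false, s) /\ a = K.
  clear rk rr; move: q1 q2; rewrite q1' q2'.
  by case: s d {u v v' q1' q2'} => [] [[] []]; rewrite /dir_x /dir_y /sgn /=; (do ?[by move=> *; exfalso; lra]) => *; split => //; lra.
have r'E : r' = r0 by apply: ring_radius_inj; rewrite (ring_radius_k rk); lra.
right; exists v'; split; [|by right|by right; rewrite /v /v' r'E dE].
by apply: plane_eq; rewrite ?q1 ?q2 /= (ring_radius_k rk) /dir_x /dir_y /=; lra.
Qed.

Lemma fan_fan_meet i r s i' r' s' q : r = k :> nat -> r' = k :> nat ->
  let v := Some (i, r, (false, s)) in let v' := Some (i', r', (false, s')) in
  segment (ring_pt None) (ring_pt v) q -> segment (ring_pt None) (ring_pt v') q ->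
  meet_at q None v None v'.
Proof.
move=> rk rk' v v' /(fan_segment rk)[t t01 [q1 q2]] /(fan_segment rk')[t' t01' [q1' q2']].
have K1 := K_ge1.
have p0 : 1 <= p%:R :> R by rewrite ler1n; apply: leq_ltn_trans (leq0n i) (ltn_ord i).
have H0 : 0 < H by rewrite /H !mulr_gt0 //; lra.
have tt : t' = t.
  by move: q2; rewrite q2' => /oppr_inj/(mulIf (lt0r_neq0 H0)).
subst t'; have [t1|t1] := eqVneq t 1.
  right; exists None; split; [|by left|by left].
  by apply: plane_eq; rewrite ?q1 ?q2 /= t1; lra.
have W : ring_center i + K * sgn s = ring_center i' + K * sgn s'.
  apply: (mulfI (x := 1 - t)); last by rewrite -q1 -q1'.
  by rewrite subr_eq0 eq_sym.
have ii : i = i'.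
  by apply: ring_center_close; move: W; case: s s' {v v' q1 q1'} => [] [] /=; rewrite /sgn; lra.
left; split => //; rewrite /v /v' ii (_ : r = r'); last by apply: val_inj; rewrite /= rk.
congr (Some (_, (_, _))); apply: sgn_inj.
by move: W; rewrite ii => /addrI/mulfI; apply; apply: lt0r_neq0; lra.
Qed.

Lemma oriented_edge_meet u v u' v' q : oriented_edge u v -> oriented_edge u' v' ->
  segment (ring_pt u) (ring_pt v) q -> segment (ring_pt u') (ring_pt v') q ->
  meet_at q u v u' v'.
Proof.
case=> [i r s1 s2|i r r' d rr|i r s rk]; case=> [i0 r0 s3 s4|i0 r0 r0' d0 rr0|i0 r0 s0 rk0] S1 S2.
- exact: ring_ring_meet.
- exact: ring_radial_meet.
- by apply: meet_at_sym; apply: fan_ring_meet.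
- by apply: meet_at_sym; apply: ring_radial_meet.
- exact: radial_radial_meet.
- by apply: meet_at_sym; apply: fan_radial_meet.
- exact: fan_ring_meet.
- exact: fan_radial_meet.
- exact: fan_fan_meet.
Qed.

End RingDrawing.

Lemma segment_sub_sym (R : realType) (a b : plane R) : segment a b `<=` segment b a.
Proof.
move=> _ [t + <-]; rewrite /= in_itv /= => /andP[t0 t1].
exists (1 - t); first by rewrite /= in_itv /=; lra.
apply: plane_eq; rewrite !(line_fst, line_snd); ring.
Qed.

Lemma segment_sym (R : realType) (a b : plane R) : segment a b = segment b a.
Proof. by apply/seteqP; split; exact: segment_sub_sym. Qed.

Lemma segment_is_arc (R : realType) (a b : plane R) : a <> b -> is_arc a b (segment a b).
Proof.
move=> ab; exists (fun t : R => a + t *: (b - a)); split => //.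
- apply: continuous_subspaceT => t.
  by apply: cvgD; [exact: cvg_cst|apply: cvgZ; [exact: cvg_id|exact: cvg_cst]].
- move=> t t' _ _ /addrI/eqP; rewrite -subr_eq0 -scalerBl scaler_eq0 !subr_eq0.
  by case/orP => /eqP // ba; case: ab.
- by rewrite scale0r addr0.
- by rewrite scale1r subrKC.
Qed.

(** * Recognizing outer vertices and bounding the number of rounds *)

Section Peeling.
Variables (R : realType) (G : sgraph) (E : plane_embedding R G).

(** The open ray is connected, unbounded and disjoint from the drawing, hence part of the outer
    face, and [v] is in its closure. *)
Lemma ray_outer_vertex (S : set G) v (dir : plane R) : dir != 0 -> S v ->
  (forall s : R, 0 < s -> ~ drawing E S (vertex_pt E v + s *: dir)) ->
  outer_vertices E S v.
Proof.
move=> d0 Sv nD; split => //.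
pose X := [set vertex_pt E v + s *: dir | s in [set s : R | 0 < s]].
have nd0 : 0 < `|dir| by rewrite normr_gt0.
have XF : X `<=` outer_face E S.
  apply: outer_face_unbounded.
  - apply: convex_connected => _ _ [s /= s0 <-] [s' /= s'0 <-] _ [t + <-].
    rewrite /= in_itv /= => /andP[t0 t1]; exists (s + t * (s' - s)).
      have [->|t1'] := eqVneq t 1; first by rewrite /= mul1r subrKC.
      have -> : s + t * (s' - s) = (1 - t) * s + t * s' by ring.
      apply: ltr_wpDr; first by rewrite mulr_ge0 // ltW.
      by rewrite mulr_gt0 // subr_gt0 lt_neqAle t1'.
    by apply: plane_eq; rewrite /= -![_ *: _]/(_ * _) /=; ring.
  - by move=> _ [s s0 <-]; exact: nD.
  - move=> [B [_ /(_ (`|B| + 1))HM]].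
    have BB : B < `|B| + 1 by rewrite ltr_pwDr // ler_norm.
    pose s := (`|B| + 1 + `|vertex_pt E v| + 1) / `|dir|.
    have s0 : 0 < s.
      by rewrite divr_gt0 //; have := normr_ge0 B; have := normr_ge0 (vertex_pt E v); lra.
    have /(_ (ex_intro2 _ _ s s0 erefl)) /= := HM BB (vertex_pt E v + s *: dir).
    have := lerB_normD (s *: dir) (vertex_pt E v).
    have -> : `|s *: dir| = `|B| + 1 + `|vertex_pt E v| + 1.
      by rewrite normrZ gtr0_norm // divfK // gt_eqF.
    by rewrite (addrC (s *: dir)); lra.
apply: closure_subset XF _ _ => A /(@nbhs_normP R (plane R))[e /= e0 eA].
pose s := e / 2 / `|dir|.
have s0 : 0 < s by rewrite !divr_gt0.
exists (vertex_pt E v + s *: dir); split; first by exists s.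
apply: eA; rewrite /= opprD addNKr normrN normrZ gtr0_norm // /s divfK ?gt_eqF //; lra.
Qed.

(** It suffices that [Z t] bounds what remains after [t] rounds: by monotonicity, a remaining vertex
    that is outer in the bound is outer in the actual set. The exact outer vertices of each round
    need not be determined. *)
Lemma outerplane_chain (Z : nat -> set G) m (S : set G) :
  (forall t, (t < m)%N -> Z t `\` outer_vertices E (Z t) `<=` Z t.+1) ->
  Z m = set0 -> S !=set0 -> S `<=` Z 0%N ->
  exists2 m', (0 < m' <= m)%N & outerplane_on E m' S.
Proof.
elim: m Z S => [|m IH] Z S ZS Zm S0 SZ.
  by have [v /SZ] := S0; rewrite Zm.
have [S'0|/set0P S'N] := eqVneq (S `\` outer_vertices E S) set0.
  exists 1%N => //; split => // v Sv; apply: contrapT => nO.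
  by suff : set0 v by []; rewrite -S'0.
have [||||m' /andP[m'0 m'm] H] := IH (fun t => Z t.+1) (S `\` outer_vertices E S) => //.
- by move=> t tm; apply: ZS.
- move=> v [Sv nO]; apply: ZS => //; split; first exact: SZ.
  by move=> Ov; apply: nO; apply: outer_vertices_antimono SZ _ _.
- exists m'.+1; first by [].
  by case: m' m'0 H {m'm}.
Qed.

End Peeling.

(** * The drawing as a plane embedding, and its layers *)

Section RingEmbedding.
Variables (R : realType) (p k : nat).
Local Notation V := (ring_vertex p k).
Local Notation G := (ring_graph p k).
Local Notation pt := (@ring_pt R p k).
Local Notation cen := (@ring_center R k).
Local Notation rad := (@ring_radius R).
Local Notation K := (k.+1%:R : R).
Local Notation depth := (4 * K * p%:R : R).
Implicit Types (i : 'I_p) (r : 'I_k.+1) (d : bool * bool) (u v w : V).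

Lemma ring_pt_inj : injective pt.
Proof.
have K1 := @K_ge1 R k.
have nN i r d : pt None <> pt (Some (i, r, d)).
  have p0 : 1 <= p%:R :> R by rewrite ler1n; apply: leq_ltn_trans (leq0n i) (ltn_ord i).
  have HK : K < depth by nra.
  have rK := @ring_radius_leK R k r; have r1 := @ring_radius_ge1 R k r.
  move=> /(congr1 snd) /=; case: d => [[] []]; rewrite /dir_y /sgn /=; lra.
move=> [[[i r] d]|] [[[i' r'] d']|] //.
- move=> E; have /= E1 := congr1 fst E; have /= E2 := congr1 snd E; move: E1 E2 {E}.
  have rK := @ring_radius_leK R k r; have r1 := @ring_radius_ge1 R k r.
  have rK' := @ring_radius_leK R k r'; have r1' := @ring_radius_ge1 R k r'.
  move=> E1 E2; have ii : i = i'.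
    apply: (@ring_center_close R p k); move: E1.
    by case: d d' {E2} => [[] []] [[] []]; rewrite /dir_x /sgn /=; lra.
  subst i'; have [dd rr] : d = d' /\ rad r = rad r'.
    move: E1 E2; case: d d' => [[] []] [[] []]; rewrite /dir_x /dir_y /sgn /=;
    (do ?[by move=> *; exfalso; lra]) => *; split => //; lra.
  by rewrite dd (ring_radius_inj rr).
- by move=> /esym/nN.
- by move=> /nN.
Qed.

Definition ring_arc u v : set (plane R) := segment (pt u) (pt v).

Lemma ring_arc_oriented u v : ring_adj u v -> exists a b,
  [/\ oriented_edge a b, ring_arc u v = ring_arc a b &
      (a = u /\ b = v) \/ (a = v /\ b = u)].
Proof.
by case/ring_adj_oriented => o; [exists u, v|exists v, u]; split => //;
  [left|rewrite /ring_arc segment_sym|right].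
Qed.

Lemma ring_arc_meet u v u' v' q : ring_adj u v -> ring_adj u' v' ->
  (u, v) <> (u', v') -> (u, v) <> (v', u') -> ring_arc u v q -> ring_arc u' v' q ->
  exists w, [/\ q = pt w, w = u \/ w = v & w = u' \/ w = v'].
Proof.
move=> /ring_arc_oriented[a [b [ab -> abE]]] /ring_arc_oriented[a' [b' [ab' -> abE']]].
move=> n1 n2 q1 q2; case: (oriented_edge_meet ab ab' q1 q2) => [[aa bb]|[w [qw w1 w2]]].
  exfalso; subst a' b'.
  case: abE abE' n1 n2 => [[<- <-]|[<- <-]] [[<- <-]|[<- <-]] n1 n2;
  by [apply: n1|apply: n2].
exists w; split => //.
- by case: abE w1 => [[-> ->]|[-> ->]] // [->|->]; [right|left].
- by case: abE' w2 => [[-> ->]|[-> ->]] // [->|->]; [right|left].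
Qed.

Lemma ring_vertex_edge u v w : ring_adj u v ->
  exists a b, oriented_edge a b /\ (w = a \/ w = b).
Proof.
case: w => [[[i r] [[] s]]|].
- by exists (Some (i, r, (false, s))), (Some (i, r, (true, s))); split; [exact: RingEdge|right].
- by exists (Some (i, r, (false, s))), (Some (i, r, (true, s))); split; [exact: RingEdge|left].
- suff Hi i : exists a b : V, oriented_edge a b /\ (None = a \/ None = b).
    by case: u v => [[[i r] d]|] [[[i' r'] d']|] // _; apply: Hi.
  by exists None, (Some (i, ord_max, (false, false))); split; [exact: FanEdge|left].
Qed.

(** Every vertex is an end of some edge, so this reduces to how two edges meet. *)
Lemma ring_arc_vertex u v w : ring_adj u v -> ring_arc u v (pt w) -> w = u \/ w = v.
Proof.
move=> uv; have [a' [b' [ab' wE]]] := ring_vertex_edge w uv.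
have [a [b [ab -> abE]]] := ring_arc_oriented uv => qw.
have qw' : segment (pt a') (pt b') (pt w).
  by case: wE => ->; have [] := segment_continuum (pt a') (pt b').
have wab : w = a \/ w = b.
  case: (oriented_edge_meet ab ab' qw qw') => [[-> ->]//|[w' [/ring_pt_inj <- ? _]]//].
by case: abE wab => [[-> ->]|[-> ->]] // [->|->]; [right|left].
Qed.

Definition ring_embedding : plane_embedding R G.
Proof.
apply: (@PlaneEmbedding R G pt ring_arc).
- exact: ring_pt_inj.
- by move=> u v _; exact: segment_sym.
- by move=> u v uv; apply: segment_is_arc => /ring_pt_inj; exact: (@adj_neq G).
- by move=> u v w; exact: ring_arc_vertex.
- by move=> u v x y uv xy n1 n2 q; exact: ring_arc_meet.
Defined.

(* The south vertex of the outermost ring is enclosed by the edges at [None],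
   so that it is removed together with the second ring. *)
Definition layer (t : nat) : set G :=
  if t == 0%N then setT else
  [set v | exists i r d, v = Some (i, r, d) /\
     ((r + t < k.+1)%N \/ [/\ t = 1%N, r = k :> nat & d = (true, true)])].

Lemma ring_radius_layer r t : (r + t < k.+1)%N -> rad r <= K - t%:R.
Proof. by move=> rt; rewrite /ring_radius lerBrDr -natrD ler_nat addSn. Qed.

Lemma layerP t v : layer t v -> match v with
  | None => t = 0%N
  | Some (i, r, d) => (r + t < k.+1)%N \/ [/\ t = 1%N, r = k :> nat & d = (true, true)]
  end.
Proof.
rewrite /layer; case: t => [|t] /=.
  by case: v => [[[i r] d]|] // _; left; rewrite addn0.
by move=> [i [r [d [-> H]]]].
Qed.

(** A coarse container of the drawing, against which rays are tested: diamonds that shrink with [t],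
    and a region below for the edges at [None]. Once [None] is gone, that region only has to hold
    the lowest radial edges, on the vertical axes of the copies. *)
Lemma drawing_layer t (q : plane R) : (t <= k)%N -> drawing ring_embedding (layer t) q ->
  (exists i, `|q.1 - cen i| + `|q.2| <= K - t%:R) \/
  [/\ q.2 <= 0, - depth <= q.2 & (0 < t)%N -> exists i, q.1 = cen i /\ `|q.2| <= K].
Proof.
move=> tk; have K1 := @K_ge1 R k.
have H0 : 0 <= depth by rewrite !mulr_ge0.
have HK i : K <= depth.
  have p0 : 1 <= p%:R :> R by rewrite ler1n; apply: leq_ltn_trans (leq0n i) (ltn_ord i).
  by nra.
have n1 b : `|@sgn R b| = 1 by case: b; rewrite /sgn ?normrN normr1.
have nd d : `|@dir_x R d| + `|@dir_y R d| = 1.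
  by case: d => [[] b]; rewrite /dir_x /dir_y /= n1 normr0 ?addr0 ?add0r.
have edge a b : oriented_edge a b -> layer t a -> layer t b -> segment (pt a) (pt b) q ->
  (exists i, `|q.1 - cen i| + `|q.2| <= K - t%:R) \/
  [/\ q.2 <= 0, - depth <= q.2 & (0 < t)%N -> exists i, q.1 = cen i /\ `|q.2| <= K].
- case=> [i r s s'|i r r' d rr|i r s rk] /layerP La /layerP Lb.
  + move=> /ring_segment[x [y [x0 y0 xy [-> ->]]]]; left; exists i.
    rewrite addrAC subrr add0r !normrM !n1 !mulr1 !ger0_norm // xy; apply: ring_radius_layer.
    by case: La => // -[].
  + move=> /(radial_segment rr)[x /andP[rx xr] [-> ->]].
    have r1 := @ring_radius_ge1 R k r; have x0 : 0 <= x := le_trans (le_trans ler01 r1) rx.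
    case: Lb => [rt|[t1 r'k dE]].
      left; exists i; rewrite addrAC subrr add0r !normrM !(ger0_norm x0) -mulrDr nd mulr1.
      by apply: le_trans (ring_radius_layer rt); rewrite (ring_radiusS R rr).
    have rK := @ring_radius_leK R k r'; have rS := ring_radiusS R rr.
    clear La t1 r'k rr; right; subst d; rewrite /dir_x /dir_y /sgn /= mulr0 addr0 mulrN1 normrN ger0_norm //.
    have HKi := HK i; clear HK; split; [lra|lra|move=> _; exists i; split => //; lra].
  + move=> /(fan_segment rk)[x /andP[x0 x1] [_ ->]]; right; split.
    * by rewrite oppr_le0 mulr_ge0.
    * by rewrite lerN2 ler_piMl.
    * by rewrite La.
case=> [[v Lv ->]|[u [v [Lu Lv uv]]]]; last first.
  have [a [b [ab E abE]]] := ring_arc_oriented uv.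
  rewrite /= E; apply: (edge _ _ ab).
    by case: abE => -[-> _].
  by case: abE => -[_ ->].
case: v Lv => [[[i r] d]|] /layerP; last first.
  by move=> ->; right; rewrite /= oppr_le0.
have r1 := @ring_radius_ge1 R k r; have r0 : 0 <= rad r := le_trans ler01 r1.
have rK := @ring_radius_leK R k r.
case=> [rt|[t1 rk ->]].
  left; exists i; rewrite /= addrAC subrr add0r !normrM !(ger0_norm r0) -mulrDr nd mulr1.
  exact: ring_radius_layer.
clear t1 rk; right; rewrite /= /dir_x /dir_y /sgn /= mulr0 addr0 mulrN1 normrN ger0_norm //.
have HKi := HK i; clear HK; split; [lra|lra|move=> _; exists i; split => //; lra].
Qed.

(** A vertical ray works for the east, west and north vertices: going up, it moves away from its own
    diamond in the L1 norm, stays far from the other copies and never enters the region below. *)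
Lemma layer_vertical i r d t : (t <= k)%N -> (k <= r + t)%N -> d != (true, true) ->
  layer t (Some (i, r, d)) -> outer_vertices ring_embedding (layer t) (Some (i, r, d)).
Proof.
move=> tk krt dS Lv; have K1 := @K_ge1 R k.
have t0 : 0 <= t%:R :> R by [].
have rt : K - t%:R <= rad r.
  by rewrite /ring_radius lerBlDr -natrD ler_nat addSn ltnS.
have r1 := @ring_radius_ge1 R k r; have rK := @ring_radius_leK R k r.
apply: (@ray_outer_vertex _ _ _ _ _ ((0, 1) : plane R)) => //.
  by apply/eqP => /(congr1 snd) /= /eqP; rewrite oner_eq0.
move=> s s0; set q := _ + _ => /(drawing_layer tk).
have q1 : q.1 = cen i + rad r * dir_x R d.
  by rewrite /q /= -[_ *: _]/(_ * _) mulr0 addr0.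
have q2 : q.2 = rad r * dir_y R d + s.
  by rewrite /q /= -[_ *: _]/(_ * _) mulr1.
rewrite q1 q2 => -[[i']|[q0 _ _]]; last first.
  by move: q0 dS; case: d {Lv q q1 q2} => [[] []] //=; rewrite /dir_y /sgn /=; lra.
have [ii|ii|/val_inj <-] := ltngtP i i'.
- have := @ring_center_lt R p k _ _ ii.
  have := normr_ge0 (rad r * dir_y R d + s).
  have := ler_norm (- (cen i + rad r * dir_x R d - cen i')); rewrite normrN.
  by case: d {Lv q q1 q2 dS} => [[] []] /=; rewrite /dir_x /dir_y /sgn /=; lra.
- have := @ring_center_lt R p k _ _ ii.
  have := normr_ge0 (rad r * dir_y R d + s).
  have := ler_norm (cen i + rad r * dir_x R d - cen i').
  by case: d {Lv q q1 q2 dS} => [[] []] /=; rewrite /dir_x /dir_y /sgn /=; lra.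
- have := ler_norm (rad r * dir_y R d + s).
  have := ler_norm (cen i + rad r * dir_x R d - cen i).
  have := ler_norm (- (cen i + rad r * dir_x R d - cen i)); rewrite normrN.
  by case: d {Lv q q1 q2} dS => [[] []] //= _; rewrite /dir_x /dir_y /sgn /=; lra.
Qed.

(** A ray straight down may run along the radial edge to the outermost south vertex, still present
    for [t = 1]. The slanted one leaves this axis at once and is deeper than [K] before it meets the
    axis of another copy. *)
Lemma layer_slanted i r t : (0 < t <= k)%N -> (k <= r + t)%N ->
  layer t (Some (i, r, (true, true))) ->
  outer_vertices ring_embedding (layer t) (Some (i, r, (true, true))).
Proof.
move=> /andP[t1 tk] krt Lv; have K1 := @K_ge1 R k.
have t0 : 0 <= t%:R :> R by [].
have rt : K - t%:R <= rad r.
  by rewrite /ring_radius lerBlDr -natrD ler_nat addSn ltnS.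
have r1 := @ring_radius_ge1 R k r; have rK := @ring_radius_leK R k r.
apply: (@ray_outer_vertex _ _ _ _ _ ((1, - 2) : plane R)) => //.
  by apply/eqP => /(congr1 fst) /= /eqP; rewrite oner_eq0.
move=> s s0; set q := _ + _ => /(drawing_layer tk).
have q1 : q.1 = cen i + s.
  by rewrite /q /= -[_ *: _]/(_ * _) /dir_x /= mulr1; lra.
have q2 : q.2 = - rad r - 2 * s.
  by rewrite /q /= -[_ *: _]/(_ * _) /dir_y /sgn /=; lra.
have n2 : `|q.2| = rad r + 2 * s by rewrite ler0_norm q2; lra.
case=> [[i']|[_ _ /(_ t1)[i' [q1' q2K]]]].
  rewrite n2 q1; have [ii|ii|/val_inj <-] := ltngtP i i'.
  - have := @ring_center_lt R p k _ _ ii.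
    have := ler_norm (- (cen i + s - cen i')); rewrite normrN; lra.
  - have := @ring_center_lt R p k _ _ ii.
    have := ler_norm (cen i + s - cen i'); lra.
  - have := ler_norm (cen i + s - cen i); lra.
rewrite n2 in q2K; rewrite q1 in q1'.
have ii : i = i' by apply: (@ring_center_close R p k); lra.
by rewrite ii in q1'; lra.
Qed.

Lemma layer_apex : (0 < p)%N -> outer_vertices ring_embedding (layer 0) None.
Proof.
move=> p0; have K1 := @K_ge1 R k.
have HK : K < depth by have p1 : 1 <= p%:R :> R; [rewrite ler1n|nra].
apply: (@ray_outer_vertex _ _ _ _ _ ((0, - 1) : plane R)) => //.
  by apply/eqP => /(congr1 snd) /= /eqP; rewrite oppr_eq0 oner_eq0.
move=> s s0; set q := _ + _ => /(drawing_layer (leq0n k)).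
have q2 : q.2 = - depth - s by rewrite /q /= -[_ *: _]/(_ * _) mulrN1.
have n2 : `|q.2| = depth + s by rewrite ler0_norm q2; lra.
case=> [[i']|[_]]; last by rewrite q2; lra.
rewrite n2 subr0; have := normr_ge0 (q.1 - cen i'); lra.
Qed.

Lemma layer_step t : (0 < p)%N -> (t <= k)%N ->
  layer t `\` outer_vertices ring_embedding (layer t) `<=` layer t.+1.
Proof.
move=> p0 tk v [Lv nO]; rewrite /layer /=.
case: v Lv nO => [[[i r] d]|] Lv nO; last first.
  by move: nO; rewrite (layerP Lv) => -[]; exact: layer_apex.
exists i, r, d; split => //.
have [rt|krt] := ltnP (r + t.+1) k.+1; first by left.
rewrite addnS ltnS in krt; right.
have dS : d = (true, true).
  by apply/eqP/negPn/negP => dS; apply: nO; exact: layer_vertical.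
have t0 : t = 0%N.
  apply/eqP; rewrite -leqn0 leqNgt; apply/negP => t0.
  by apply: nO; rewrite dS in Lv *; apply: layer_slanted => //; rewrite t0.
split; [by rewrite t0| |by []].
by apply/eqP; rewrite eqn_leq -ltnS ltn_ord /= -[X in (_ <= X)%N]addn0 -t0.
Qed.

Lemma ring_graph_outerplanar : (1 < p)%N -> (0 < k)%N -> outerplanar R k.+1 G.
Proof.
move=> p1 k0; split; last first.
  by move=> m mk [E /(ring_graph_layers p1)]; rewrite ltnNge -ltnS mk.
have [m /andP[_ mk] Hm] : exists2 m, (0 < m <= k.+1)%N & outerplane_on ring_embedding m setT.
  apply: (@outerplane_chain R G ring_embedding layer) => //.
  - by move=> t tk; apply: layer_step => //; exact: ltnW.
  (* Here [0 < k] matters: with a single ring, [layer 1] would still contain the south vertices. *)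
  - apply/seteqP; split => // v /layerP; case: v => [[[i r] d]|] //.
    by case=> [|[]]; [lia|move=> [k00]; rewrite k00 in k0].
  - by exists None.
exists ring_embedding; have km := ring_graph_layers p1 Hm.
by have -> : k.+1 = m by apply/eqP; rewrite eqn_leq km mk.
Qed.

End RingEmbedding.

(** * The case of one layer, and the constant *)

Definition edgeless (n : nat) : sgraph :=
  @SGraph 'I_n (fun _ _ => false) (fun _ _ => erefl) (fun _ => erefl).

Definition edgeless_embedding (R : realType) n : plane_embedding R (edgeless n).
Proof.
apply: (@PlaneEmbedding R (edgeless n) (fun i : 'I_n => ((i : nat)%:R, 0)) (fun _ _ => set0)) => //.
by move=> i j /(congr1 fst) /= /eqP; rewrite eqr_nat => /eqP/val_inj.
Defined.

Lemma edgeless_outerplanar (R : realType) n : outerplanar R 1 (edgeless n.+1).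
Proof.
split; last by move=> [|//] _ [].
exists (edgeless_embedding R n.+1); split; first by exists (ord0 : 'I_n.+1).
move=> v _; apply: (@ray_outer_vertex _ _ _ _ _ ((0, 1) : plane R)) => //.
  by apply/eqP => /(congr1 snd) /= /eqP; rewrite oner_eq0.
move=> s s0 [[w _ /(congr1 snd)]|[u [w []]]//] /=.
by rewrite -[_ *: _]/(_ * _) mulr1 add0r => s00; rewrite s00 ltxx in s0.
Qed.

Lemma pixel_size_ge (G : sgraph) (B : G -> {fset pixel}) :
  pixel_representation B -> (#|G| <= pixel_size B)%N.
Proof.
move=> HB; rewrite /pixel_size -sum1_card; apply: leq_sum => v _.
by rewrite cardfs_gt0; have [] := pixel_rep_blob HB v.
Qed.

Lemma card_ring_graph p k : #|ring_graph p k| = (4 * k.+1 * p).+1.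
Proof.
by rewrite card_option !card_prod !card_ord card_bool mulnC [(p * _)%N]mulnC mulnA.
Qed.

Lemma double_sum_ord m : (2 * \sum_(j < m) j.+1 = m * m.+1)%N.
Proof. by elim: m => [|m IH]; rewrite ?big_ord0 // big_ord_recr /= mulnDr IH; lia. Qed.

Theorem theorem4 (R : realType) :
  exists c : R, 0 < c /\
    forall k : nat, (1 <= k)%N ->
    forall N : nat, exists n : nat, (N <= n)%N /\
    exists G : sgraph, [/\ #|G| = n, outerplanar R k G &
      forall B : G -> {fset pixel}, pixel_representation B ->
        c * k%:R * n%:R <= (pixel_size B)%:R].
Proof.
(* With K > 1 layers and p copies, n = 4Kp + 1 and the size is at least (p - 1)K(K + 1)/2. As p <=
   2(p - 1), the product Kn is at most 16 times this bound, so 20 leaves some room. *)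
exists 20%:R^-1; split; first by rewrite invr_gt0 ltr0n.
have bound k n m : (k * n <= 20 * m)%N -> 20%:R^-1 * k%:R * n%:R <= m%:R :> R.
  move=> h; rewrite -mulrA ler_pdivrMl ?ltr0n //.
  by rewrite -!natrM ler_nat.
move=> [//|[|k]] _ N.
  exists N.+1; split; first exact: leqnSn.
  exists (edgeless N.+1); split; [exact: card_ord|exact: edgeless_outerplanar|].
  move=> B /pixel_size_ge; rewrite card_ord => size_ge.
  by apply: bound; lia.
(* At least two copies are needed, since one is given up. The parameter of [ring_graph] is one less
   than the number of rings. *)
pose p := (N + 2)%N; exists (4 * k.+2 * p).+1; split; first by rewrite /p; nia.
exists (ring_graph p k.+1); split; first exact: card_ring_graph.
  by apply: ring_graph_outerplanar => //; rewrite /p addn2.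
move=> B /ring_pixel_size; rewrite {1}/p addn2 => /(_ isT) size_ge; apply: bound.
have := double_sum_ord k.+2; move: size_ge; rewrite /p.
move: (pixel_size B) (\sum_(_ < _) _)%N => m S; rewrite addn2 /=.
nia.
Qed.
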